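(* Let $F:S^1\times[0,T)\to\mathbb{R}^2$ be a smooth family of strictly convex closed plane curves satisfying $$\begin{cases}\dfrac{\partial^{2} F}{\partial t^{2}}(u,t)=k(u,t)\vec{N}(u,t)-\nabla\rho(u,t), & (u,t)\in S^{1}\times[0,T),\\ F(u,0)=F_{0}(u),\\ \dfrac{\partial F}{\partial t}(u,0)=f(u)\vec{N}_0(u),\end{cases}\qquad \nabla\rho=\left\langle\frac{\partial^{2}F}{\partial s\,\partial t},\frac{\partial F}{\partial t}\right\rangle\vec{T},$$ where $F_0$ is a smooth strictly convex closed curve with unit inner normal $\vec N_0$ and $f\ge 0$ is a smooth function on $S^1$. Let $S(\theta,\tau)$ be the support function of $F(\cdot,\tau)$. Then $S$ satisfies the initial value problem $$\begin{cases} S\,S_{\tau\tau}+S_{\tau\tau}S_{\theta\theta}-S_{\theta\tau}^{2}+1=0, & (\theta,\tau)\in S^1\times[0,T),\\ S(\theta,0)=h(\theta),\\ S_{\tau}(\theta,0)=-\widetilde{f}(\theta),\end{cases}$$ where $h$ is the support function of $F_0$ and $\widetilde f(\theta)$ is the initial velocity $f$ expressed in terms of the outer normal angle $\theta$ of $F_0$. Moreover, this equation is a $\tau$-hyperbolic Monge-Ampère equation on $S$.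
   Context: For a family of closed plane curves $F(\cdot,t):S^1\to\mathbb{R}^2$: $\vec T$ is the unit tangent vector, $\vec N$ the unit inner normal vector, $k$ the curvature (with respect to $\vec N$), $s$ the arclength parameter, $\frac{\partial}{\partial s}=\frac{1}{|\partial F/\partial u|}\frac{\partial}{\partial u}$, and $\frac{\partial^2F}{\partial s\,\partial t}=\frac{\partial}{\partial s}\left(\frac{\partial F}{\partial t}\right)$. Normal angle parametrization: for a strictly convex curve the unit outer normal angle $\theta$ is defined by $\vec N=(-\cos\theta,-\sin\theta)$, $\vec T=(-\sin\theta,\cos\theta)$. One writes $\widetilde F(\theta,\tau)=F(u(\theta,\tau),\tau)$ for the curve at time $t=\tau$ parametrized by $\theta$ (i.e. $\widetilde F(\theta,\tau)$ is the point of $F(\cdot,\tau)$ with outer normal angle $\theta$). The support function is $S(\theta,\tau)=\langle\widetilde F(\theta,\tau),(\cos\theta,\sin\theta)\rangle$; the curvature is $k=\frac{1}{S_{\theta\theta}+S}$. A Monge-Ampère equation $A+Bz_{\tau\tau}+Cz_{\tau\theta}+Dz_{\theta\theta}+E(z_{\tau\tau}z_{\theta\theta}-z_{\theta\tau}^2)=0$, with coefficients $A,B,C,D,E$ depending on $\tau,\theta,z,z_\tau,z_\theta$, is called $\tau$-hyperbolic for $z$ if $C^2-4BD+4AE>0$ and $z_{\theta\theta}+B\neq0$ (here $E=1$). *)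

(* Defs.v *)
From Stdlib Require Import Reals ClassicalEpsilon.
From Coquelicot Require Import Coquelicot.
Open Scope R_scope.

(** Functions on the circle are 2π-periodic functions on [R], and the plane is
    [R * R] with Coquelicot's module operations [minus] and [scal].  The final
    time [T] may be finite or [p_infty]. *)

Definition periodic {V : Type} (g : R -> V) : Prop :=
  forall u, g (u + 2 * PI) = g u.

Definition time_dom (T : Rbar) (t : R) : Prop := 0 <= t /\ Rbar_lt t T.

(** * Derivatives and smoothness on S¹ × [0,T) *)

(** Derivative of [f] at [x] taken along [D]: two-sided at interior points of
    [D] (then it agrees with [is_derive]), one-sided at a boundary point. *)
Definition is_derive_within (D : R -> Prop) (f : R -> R) (x l : R) : Prop :=
  filterdiff f (within D (locally x)) (fun h : R => scal h l).

Definition ex_derive_within (D : R -> Prop) (f : R -> R) (x : R) : Prop :=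
  exists l : R, is_derive_within D f x l.

(** A total operator; the value is meaningful when [ex_derive_within] holds and
    [x] is a limit point of [D]. *)
Definition Derive_within (D : R -> Prop) (f : R -> R) (x : R) : R :=
  iota (is_derive_within D f x).

Definition D_space (g : R -> R -> R) (x t : R) : R :=
  Derive (fun y => g y t) x.

Definition D_time (T : Rbar) (g : R -> R -> R) (x t : R) : R :=
  Derive_within (time_dom T) (g x) t.

Definition continuous_family (T : Rbar) (g : R -> R -> R) : Prop :=
  forall x t, time_dom T t ->
    filterlim (fun p : R * R => g (fst p) (snd p))
      (within (fun p : R * R => time_dom T (snd p)) (locally (x, t)))
      (locally (g x t)).

(** [C_n T n g]: [g] is of class C^n on R × [0,T), boundary included. *)
Fixpoint C_n (T : Rbar) (n : nat) (g : R -> R -> R) : Prop :=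
  continuous_family T g /\
  match n with
  | O => True
  | S m =>
      (forall x t, time_dom T t ->
         ex_derive (fun y => g y t) x /\
         ex_derive_within (time_dom T) (g x) t) /\
      C_n T m (D_space g) /\ C_n T m (D_time T g)
  end.

Definition smooth_fun (g : R -> R) : Prop := forall n x, ex_derive_n g n x.

Definition smooth_curve (c : R -> R * R) : Prop :=
  smooth_fun (fun u => fst (c u)) /\ smooth_fun (fun u => snd (c u)).

Definition smooth_family (T : Rbar) (F : R -> R -> R * R) : Prop :=
  forall n, C_n T n (fun u t => fst (F u t)) /\ C_n T n (fun u t => snd (F u t)).

(** * Geometry of plane curves *)

Definition dot (v w : R * R) : R := fst v * fst w + snd v * snd w.

Definition vDerive (c : R -> R * R) (u : R) : R * R :=
  (Derive (fun v => fst (c v)) u, Derive (fun v => snd (c v)) u).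

Definition vD_time (T : Rbar) (F : R -> R -> R * R) (u t : R) : R * R :=
  (D_time T (fun v r => fst (F v r)) u t, D_time T (fun v r => snd (F v r)) u t).

Definition speed (c : R -> R * R) (u : R) : R :=
  sqrt (dot (vDerive c u) (vDerive c u)).

(** Derivative of [G] with respect to the arclength of [c]. *)
Definition D_arclength (c G : R -> R * R) (u : R) : R * R :=
  scal (/ speed c u) (vDerive G u).

Definition unit_tangent (c : R -> R * R) : R -> R * R := D_arclength c c.

(** Curves are positively oriented, as the convention
    T = (- sin θ, cos θ), N = (- cos θ, - sin θ) imposes; N is T rotated by π/2.
    For the curves considered, [strictly_convex] states that it points inwards. *)
Definition inner_normal (c : R -> R * R) (u : R) : R * R :=
  (- snd (unit_tangent c u), fst (unit_tangent c u)).

(** Frenet: ∂T/∂s = k N. *)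
Definition curvature (c : R -> R * R) (u : R) : R :=
  dot (D_arclength c (unit_tangent c) u) (inner_normal c u).

(** Away from the point of contact the curve lies strictly on the inner side of
    each of its tangent lines (so it is simple), and its curvature is positive. *)
Definition strictly_convex (c : R -> R * R) : Prop :=
  (forall u, vDerive c u <> (0, 0)) /\
  (forall u v, (forall m : Z, v <> u + IZR m * (2 * PI)) ->
     0 < dot (minus (c v) (c u)) (inner_normal c u)) /\
  (forall u, 0 < curvature c u).

Definition grad_rho (T : Rbar) (F : R -> R -> R * R) (u t : R) : R * R :=
  let c := fun v => F v t in
  let Ft := fun v => vD_time T F v t in
  scal (dot (D_arclength c Ft u) (Ft u)) (unit_tangent c u).

(** * Normal angle parametrization *)

(** A parameter at which [c] has outer unit normal (cos θ, sin θ); for a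
    strictly convex closed curve it exists and is unique modulo 2π, so
    2π-periodic functions take a well-defined value there. *)
Definition normal_param (c : R -> R * R) (theta : R) : R :=
  epsilon (inhabits 0)
    (fun u => inner_normal c u = (- cos theta, - sin theta)).

Definition normal_point (c : R -> R * R) (theta : R) : R * R :=
  c (normal_param c theta).

Definition support (c : R -> R * R) (theta : R) : R :=
  dot (normal_point c theta) (cos theta, sin theta).

(** * Monge-Ampère equations *)

(** Each coefficient takes the arguments τ, θ, z, z_τ, z_θ. *)
Record MongeAmpere : Type := mkMongeAmpere {
  MA_A : R -> R -> R -> R -> R -> R;
  MA_B : R -> R -> R -> R -> R -> R;
  MA_C : R -> R -> R -> R -> R -> R;
  MA_D : R -> R -> R -> R -> R -> R;
  MA_E : R -> R -> R -> R -> R -> R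
}.

Definition at_jet (T : Rbar) (z : R -> R -> R) (theta tau : R)
    (K : R -> R -> R -> R -> R -> R) : R :=
  K tau theta (z theta tau) (D_time T z theta tau) (D_space z theta tau).

Definition MA_lhs (T : Rbar) (M : MongeAmpere) (z : R -> R -> R)
    (theta tau : R) : R :=
  let j := at_jet T z theta tau in
  j (MA_A M)
  + j (MA_B M) * D_time T (D_time T z) theta tau
  + j (MA_C M) * D_space (D_time T z) theta tau
  + j (MA_D M) * D_space (D_space z) theta tau
  + j (MA_E M) *
      (D_time T (D_time T z) theta tau * D_space (D_space z) theta tau
       - D_time T (D_space z) theta tau ^ 2).

(** The condition z_θθ + B <> 0 is the one for the normalization E = 1. *)
Definition tau_hyperbolic_at (T : Rbar) (M : MongeAmpere) (z : R -> R -> R)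
    (theta tau : R) : Prop :=
  let j := at_jet T z theta tau in
  j (MA_C M) ^ 2 - 4 * j (MA_B M) * j (MA_D M)
    + 4 * j (MA_A M) * j (MA_E M) > 0 /\
  D_space (D_space z) theta tau + j (MA_B M) <> 0.

Definition tau_hyperbolic (T : Rbar) (M : MongeAmpere) (z : R -> R -> R) : Prop :=
  forall theta tau, time_dom T tau -> tau_hyperbolic_at T M z theta tau.

(** A = 1, B = z, C = D = 0, E = 1. *)
Definition flow_MA : MongeAmpere :=
  mkMongeAmpere (fun _ _ _ _ _ => 1) (fun _ _ z _ _ => z)
    (fun _ _ _ _ _ => 0) (fun _ _ _ _ _ => 0) (fun _ _ _ _ _ => 1).

Lemma flow_MA_lhs (T : Rbar) (z : R -> R -> R) (theta tau : R) :
  MA_lhs T flow_MA z theta tau =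
  z theta tau * D_time T (D_time T z) theta tau
  + D_time T (D_time T z) theta tau * D_space (D_space z) theta tau
  - D_time T (D_space z) theta tau ^ 2 + 1.
Proof. unfold MA_lhs, at_jet, flow_MA; simpl; ring. Qed.

(* Main.v *)
(** The flow keeps the velocity normal: the tangential acceleration [- grad rho] cancels
    <F_t, F_tu>, so <F_t, F_u> is constant in time, and it vanishes at t = 0.

    Let w(theta, t) be the parameter of outer normal angle theta and n = (cos theta, sin theta).
    It is the zero of <F_u(., t), n>, which is simple because k > 0; differentiating this
    equation implicitly gives |F_u| w_theta = 1/k and <F_ut, n> = k |F_u|^2 w_t.  As
    <F_u, n> = 0 at w, the support function S = <F(w), n> has S_theta = <F(w), n'> and
    S_t = <F_t(w), n>; one more derivative yields
      S + S_thetatheta = 1/k,  S_thetat = |F_u| w_t,  S_tt = - k + k |F_u|^2 w_t^2,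
    and the equation follows. *)

Require Import Defs.
From Stdlib Require Import Reals Lra Lia ZArith Classical ClassicalEpsilon FunctionalExtensionality.
From Coquelicot Require Import Coquelicot.
Open Scope R_scope.

(** * Derivatives along [0,T) *)

(** Two obstacles shape the proof. At t = 0 only one-sided time derivatives exist, so theorems about
    open sets do not reach the initial time; and [normal_param] is an arbitrary choice modulo 2π, so
    w need not even be continuous. Derivatives are therefore put in Carathéodory form: an increment
    of the function is a slope times the increment of the variable, where the slope converges along
    a filter. Product rule, chain rule and implicit differentiation then become algebraic identities
    followed by a passage to the limit, and one argument covers interior and boundary times. As for
    w, near each base point it is replaced by a representative v congruent to it modulo 2π, shown to
    be continuous and then differentiable. Only 2π-periodic functions are ever evaluated at w, so v
    and w give the same values. Hyperbolicity comes with the same computation: the discriminant is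
    the constant 4, and since B = S the other condition says that the radius of curvature 1/k is not
    zero. *)

Lemma filterlim_Rplus {A : Type} (F : (A -> Prop) -> Prop) {FF : Filter F}
    (f g : A -> R) (a b : R) :
  filterlim f F (locally a) -> filterlim g F (locally b) ->
  filterlim (fun x => f x + g x) F (locally (a + b)).
Proof.
intros Hf Hg.
exact (filterlim_comp_2 _ _ Rplus Hf Hg (@filterlim_plus R_AbsRing R_NormedModule a b)).
Qed.

Lemma filterlim_Rmult {A : Type} (F : (A -> Prop) -> Prop) {FF : Filter F}
    (f g : A -> R) (a b : R) :
  filterlim f F (locally a) -> filterlim g F (locally b) ->
  filterlim (fun x => f x * g x) F (locally (a * b)).
Proof.
intros Hf Hg.
exact (filterlim_comp_2 _ _ Rmult Hf Hg (@filterlim_mult R_AbsRing a b)).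
Qed.

Lemma filterlim_Ropp {A : Type} (F : (A -> Prop) -> Prop) {FF : Filter F}
    (f : A -> R) (a : R) :
  filterlim f F (locally a) -> filterlim (fun x => - f x) F (locally (- a)).
Proof.
intros Hf.
apply filterlim_comp with (1 := Hf).
exact (@filterlim_opp R_AbsRing R_NormedModule a).
Qed.

Lemma filterlim_Rinv {A : Type} (F : (A -> Prop) -> Prop) {FF : Filter F}
    (f : A -> R) (a : R) :
  a <> 0 -> filterlim f F (locally a) -> filterlim (fun x => / f x) F (locally (/ a)).
Proof.
intros Ha Hf.
apply filterlim_comp with (1 := Hf).
exact (continuous_Rinv a Ha).
Qed.

Lemma filterlim_neq0 {A : Type} (F : (A -> Prop) -> Prop) {FF : Filter F}
    (f : A -> R) (a : R) :
  a <> 0 -> filterlim f F (locally a) -> F (fun x => f x <> 0).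
Proof.
intros Ha Hf.
exact (Hf (fun y => y <> 0) (open_neq 0 a Ha)).
Qed.

Lemma filterlim_gt {A : Type} (F : (A -> Prop) -> Prop) {FF : Filter F}
    (f : A -> R) (a b : R) :
  b < a -> filterlim f F (locally a) -> F (fun x => b < f x).
Proof. intros Ha Hf. exact (Hf (fun y => b < y) (open_gt b a Ha)). Qed.

Lemma filterlim_lt {A : Type} (F : (A -> Prop) -> Prop) {FF : Filter F}
    (f : A -> R) (a b : R) :
  a < b -> filterlim f F (locally a) -> F (fun x => f x < b).
Proof. intros Ha Hf. exact (Hf (fun y => y < b) (open_lt b a Ha)). Qed.

(** The filter is kept general so that one proof serves both [locally x] and its restriction to
    [0,T); properness makes x its only limit. *)
Lemma filterdiff_caratheodory (F : (R -> Prop) -> Prop) {FF : ProperFilter F}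
    (f : R -> R) (x l : R) :
  is_filter_lim F x ->
  filterdiff f F (fun h : R => scal h l) <->
  exists b : R -> R, filterlim b F (locally l) /\
    F (fun y => f y - f x = b y * (y - x)).
Proof.
intros Hx; split.
- intros [_ Hd]. specialize (Hd x Hx).
  (* The difference quotient needs the value [l] at y = x: the filters in use see the base point
     itself, so the limit also constrains the slope there. *)
  exists (fun y => match Req_EM_T y x with left _ => l | right _ => (f y - f x) / (y - x) end).
  split.
  + apply filterlim_locally. intros eps.
    assert (He : 0 < eps / 2) by (generalize (cond_pos eps); lra).
    generalize (Hd (mkposreal _ He)). apply filter_imp. simpl. intros y Hy.
    unfold ball; simpl; unfold AbsRing_ball, abs, minus, plus, opp; simpl.
    destruct (Req_EM_T y x) as [E|E].
    * replace (l + - l) with 0 by ring. rewrite Rabs_R0. apply cond_pos.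
    * unfold norm, minus, plus, opp, scal in Hy; simpl in Hy; unfold abs, mult in Hy; simpl in Hy.
      assert (Hn : 0 < Rabs (y - x)) by (apply Rabs_pos_lt; lra).
      replace ((f y - f x) / (y - x) + - l)
        with ((f y + - f x + - ((y + - x) * l)) / (y - x)) by (field; lra).
      unfold Rdiv; rewrite Rabs_mult, Rabs_inv.
      apply Rle_lt_trans with (eps / 2); [|generalize (cond_pos eps); lra].
      apply Rmult_le_reg_r with (Rabs (y - x)); [exact Hn|].
      rewrite Rmult_assoc, Rinv_l, Rmult_1_r by lra. exact Hy.
  + apply filter_forall. intros y. destruct (Req_EM_T y x) as [E|E].
    * subst y. ring.
    * field. lra.
- intros [b [Hb He]]. split; [exact (@is_linear_scal_l R_AbsRing R_NormedModule l)|].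
  intros z Hz.
  assert (z = x) by (eapply (@is_filter_lim_unique R_AbsRing R_NormedModule F); eauto; apply Proper_StrongProper, FF).
  subst z. intros eps.
  generalize (filter_and _ _ (proj1 (filterlim_locally _ _) Hb eps) He).
  apply filter_imp. intros y [H1 H2].
  unfold ball in H1; simpl in H1; unfold AbsRing_ball, abs, minus, plus, opp in H1; simpl in H1.
  unfold norm, minus, plus, opp, scal; simpl; unfold abs, mult; simpl.
  replace (f y + - f x + - ((y + - x) * l)) with ((b y + - l) * (y - x))
    by (replace (f y + - f x) with (f y - f x) by ring; rewrite H2; ring).
  rewrite Rabs_mult. apply Rmult_le_compat_r; [apply Rabs_pos|lra].
Qed.

Lemma time_dom_within_proper (T : Rbar) (t : R) :
  time_dom T t -> ProperFilter (within (time_dom T) (locally t)).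
Proof.
intros Ht. constructor; [|apply within_filter, locally_filter].
intros P HP. exists t. exact (locally_singleton _ _ HP Ht).
Qed.

Lemma within_is_filter_lim (D : R -> Prop) (t : R) :
  is_filter_lim (within D (locally t)) t.
Proof. intros P HP. unfold within. revert HP. apply filter_imp. auto. Qed.

Lemma is_derive_within_caratheodory (T : Rbar) (f : R -> R) (t l : R) :
  time_dom T t ->
  is_derive_within (time_dom T) f t l <->
  exists b : R -> R, filterlim b (within (time_dom T) (locally t)) (locally l) /\
    within (time_dom T) (locally t) (fun r => f r - f t = b r * (r - t)).
Proof.
intros Ht. apply filterdiff_caratheodory.
- apply time_dom_within_proper, Ht.
- apply within_is_filter_lim.
Qed.

Lemma is_derive_caratheodory (f : R -> R) (x l : R) :
  is_derive f x l <->
  exists b : R -> R, filterlim b (locally x) (locally l) /\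
    locally x (fun y => f y - f x = b y * (y - x)).
Proof.
apply (filterdiff_caratheodory (locally x)). intros P HP; exact HP.
Qed.

Lemma time_dom_right (T : Rbar) (t : R) :
  time_dom T t -> exists e : posreal, forall r, t <= r < t + e -> time_dom T r.
Proof.
intros [H0 H1]. destruct T as [T| |]; simpl in H1.
- assert (He : 0 < T - t) by lra.
  exists (mkposreal _ He). simpl. intros r Hr. split; simpl; lra.
- exists (mkposreal 1 Rlt_0_1). simpl. intros r Hr. split; simpl; [lra|exact I].
- contradiction.
Qed.

(** Every time in [0,T), 0 included, can be approached from the right inside the domain. Passing to
    [at_right t] excludes t itself, so r - t can be cancelled and continuity can be used to reach t
    = 0. *)
Lemma at_right_le_time (T : Rbar) (t : R) :
  time_dom T t -> filter_le (at_right t) (within (time_dom T) (locally t)).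
Proof.
intros Ht P HP. destruct (time_dom_right T t Ht) as [e He].
unfold at_right, within in *.
generalize (filter_and _ _ HP (locally_ball t e)). apply filter_imp.
intros r [H1 H2] H3. apply H1. apply He. split; [lra|].
unfold ball in H2; simpl in H2; unfold AbsRing_ball, abs, minus, plus, opp in H2; simpl in H2.
apply Rabs_def2 in H2. lra.
Qed.

Lemma is_derive_within_unique (T : Rbar) (f : R -> R) (t l1 l2 : R) :
  time_dom T t ->
  is_derive_within (time_dom T) f t l1 -> is_derive_within (time_dom T) f t l2 -> l1 = l2.
Proof.
intros Ht H1 H2.
apply is_derive_within_caratheodory in H1; [|exact Ht].
apply is_derive_within_caratheodory in H2; [|exact Ht].
destruct H1 as [b1 [L1 E1]], H2 as [b2 [L2 E2]].
assert (Hle := at_right_le_time T t Ht).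
apply (filterlim_locally_unique (K := R_AbsRing) (V := R_NormedModule) (F := at_right t) b1).
- exact (filterlim_filter_le_1 _ Hle L1).
- apply (filterlim_ext_loc b2); [|exact (filterlim_filter_le_1 _ Hle L2)].
  assert (Hr : at_right t (fun r => t < r)) by (unfold at_right, within; apply filter_forall; auto).
  generalize (filter_and _ _ Hr (filter_and _ _ (Hle _ E1) (Hle _ E2))).
  apply filter_imp. intros r [Hr' [A B]].
  apply Rmult_eq_reg_r with (r - t); lra.
Qed.

Lemma Derive_within_unique (T : Rbar) (f : R -> R) (t l : R) :
  time_dom T t -> is_derive_within (time_dom T) f t l ->
  Derive_within (time_dom T) f t = l.
Proof.
intros Ht H. unfold Derive_within.
apply (iota_unique (K := R_AbsRing) (V := R_CompleteNormedModule)); [|exact H].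
intros y Hy. exact (is_derive_within_unique T f t y l Ht Hy H).
Qed.

Lemma Derive_within_correct (T : Rbar) (f : R -> R) (t : R) :
  time_dom T t -> ex_derive_within (time_dom T) f t ->
  is_derive_within (time_dom T) f t (Derive_within (time_dom T) f t).
Proof.
intros Ht [l H]. rewrite (Derive_within_unique T f t l Ht H). exact H.
Qed.

Lemma is_derive_within_ext (T : Rbar) (f g : R -> R) (t l : R) :
  time_dom T t -> (forall r, time_dom T r -> f r = g r) ->
  is_derive_within (time_dom T) f t l -> is_derive_within (time_dom T) g t l.
Proof.
intros Ht E H.
apply is_derive_within_caratheodory in H; [|exact Ht].
apply is_derive_within_caratheodory; [exact Ht|].
destruct H as [b [L Eb]]. exists b; split; [exact L|].
unfold within in *. revert Eb. apply filter_imp. intros r H Hr.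
rewrite <- (E r Hr), <- (E t Ht). auto.
Qed.

Lemma time_dom_interior (T : Rbar) (t : R) :
  time_dom T t -> 0 < t -> locally t (time_dom T).
Proof.
intros Ht Hpos.
destruct (time_dom_right T t Ht) as [e He].
  generalize (filter_and _ _ (locally_ball t e) (open_gt 0 t Hpos)). apply filter_imp.
  intros r [H2 H3].
  unfold ball in H2; simpl in H2; unfold AbsRing_ball, abs, minus, plus, opp in H2; simpl in H2.
  apply Rabs_def2 in H2. destruct (Rle_dec t r) as [A|A]; [apply He; lra|].
  destruct Ht as [_ Ht]. split; [lra|]. destruct T; simpl in *; auto; lra.
Qed.

(** For t > 0 the domain is a neighbourhood of t, so both filters agree; this gives access to the
    classical theorems on two-sided derivatives. *)
Lemma is_derive_within_interior (T : Rbar) (f : R -> R) (t l : R) :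
  time_dom T t -> 0 < t ->
  is_derive_within (time_dom T) f t l <-> is_derive f t l.
Proof.
intros Ht Hpos. rewrite is_derive_caratheodory, is_derive_within_caratheodory by exact Ht.
assert (Hin := time_dom_interior T t Ht Hpos).
assert (Hle : filter_le (locally t) (within (time_dom T) (locally t))).
{ intros P HP. unfold within in HP. generalize (filter_and _ _ HP Hin). apply filter_imp. intros r [A B]; auto. }
assert (Hle' : filter_le (within (time_dom T) (locally t)) (locally t))
  by (intros P HP; unfold within; revert HP; apply filter_imp; auto).
split; intros [b [L E]]; exists b; split.
- exact (filterlim_filter_le_1 _ Hle L).
- exact (Hle _ E).
- exact (filterlim_filter_le_1 _ Hle' L).
- exact (Hle' _ E).
Qed.

(** * Joint differentiability on R × [0,T) *)

(** The filter along which [continuous_family] takes its limits, so continuity hypotheses apply to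
    it by conversion. *)
Definition slab_filter (T : Rbar) (x t : R) : (R * R -> Prop) -> Prop :=
  within (fun p : R * R => time_dom T (snd p)) (locally (x, t)).

Global Instance slab_filter_filter (T : Rbar) (x t : R) : Filter (slab_filter T x t).
Proof. apply within_filter, locally_filter. Qed.

Lemma slab_filter_at (T : Rbar) (x t : R) (P : R * R -> Prop) :
  time_dom T t -> slab_filter T x t P -> P (x, t).
Proof. intros Ht HP. exact (locally_singleton _ _ HP Ht). Qed.

Lemma slab_filter_dom (T : Rbar) (x t : R) :
  slab_filter T x t (fun p => time_dom T (snd p)).
Proof. unfold slab_filter, within. apply filter_forall. auto. Qed.

Lemma filterlim_slab {A : Type} (F : (A -> Prop) -> Prop) {FF : Filter F}
    (T : Rbar) (a b : A -> R) (x t : R) :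
  filterlim a F (locally x) -> filterlim b F (locally t) ->
  F (fun z => time_dom T (b z)) ->
  filterlim (fun z => (a z, b z)) F (slab_filter T x t).
Proof.
intros Ha Hb Hd P [e He].
assert (Ha' := proj1 (filterlim_locally _ _) Ha e).
assert (Hb' := proj1 (filterlim_locally _ _) Hb e).
generalize (filter_and _ _ Hd (filter_and _ _ Ha' Hb')).
unfold filtermap. apply filter_imp. intros z [A1 [A2 A3]].
apply He; [split; assumption|exact A1].
Qed.

Lemma slab_fst (T : Rbar) (x t : R) : filterlim fst (slab_filter T x t) (locally x).
Proof.
intros P [e He]. exists e. intros y [Hy _] _. apply He, Hy.
Qed.

Lemma slab_snd (T : Rbar) (x t : R) : filterlim snd (slab_filter T x t) (locally t).
Proof.
intros P [e He]. exists e. intros y [_ Hy] _. apply He, Hy.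
Qed.

Lemma slab_fst_fun (T : Rbar) (h : R -> R) (x t : R) :
  continuous h x -> filterlim (fun p => h (fst p)) (slab_filter T x t) (locally (h x)).
Proof. intros H. exact (filterlim_comp _ _ _ _ _ _ _ _ (slab_fst T x t) H). Qed.

Lemma slab_space_slice (T : Rbar) (x t : R) :
  time_dom T t -> filterlim (fun y => (y, t)) (locally x) (slab_filter T x t).
Proof.
intros Ht. apply filterlim_slab.
- apply locally_filter.
- apply filterlim_id.
- apply filterlim_const.
- apply filter_forall. auto.
Qed.

Lemma slab_time_slice (T : Rbar) (x t : R) :
  time_dom T t ->
  filterlim (fun r => (x, r)) (within (time_dom T) (locally t)) (slab_filter T x t).
Proof.
intros Ht. apply filterlim_slab.
- apply within_filter, locally_filter.
- apply filterlim_const.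
- apply within_is_filter_lim.
- unfold within. apply filter_forall. auto.
Qed.

(* Joint differentiability in Carathéodory's form: the two slopes are functions on the
   slab that tend to the partial derivatives [a] and [b]. *)
Definition slab_diff (T : Rbar) (g : R -> R -> R) (x t a b : R) : Prop :=
  exists al be : R * R -> R,
    filterlim al (slab_filter T x t) (locally a) /\
    filterlim be (slab_filter T x t) (locally b) /\
    slab_filter T x t (fun p =>
      g (fst p) (snd p) - g x t = al p * (fst p - x) + be p * (snd p - t)).

Lemma slab_diff_space (T : Rbar) (g : R -> R -> R) (x t a b : R) :
  time_dom T t -> slab_diff T g x t a b -> is_derive (fun y => g y t) x a.
Proof.
intros Ht [al [be [La [Lb E]]]].
assert (Hs := slab_space_slice T x t Ht).
apply is_derive_caratheodory. exists (fun y => al (y, t)); split.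
- exact (filterlim_comp _ _ _ _ _ _ _ _ Hs La).
- generalize (Hs _ E). unfold filtermap. apply filter_imp. simpl. intros y Hy. rewrite Hy. ring.
Qed.

Lemma slab_diff_time (T : Rbar) (g : R -> R -> R) (x t a b : R) :
  time_dom T t -> slab_diff T g x t a b -> is_derive_within (time_dom T) (g x) t b.
Proof.
intros Ht [al [be [La [Lb E]]]].
assert (Hs := slab_time_slice T x t Ht).
apply is_derive_within_caratheodory; [exact Ht|]. exists (fun r => be (x, r)); split.
- exact (filterlim_comp _ _ _ _ _ _ _ _ Hs Lb).
- generalize (Hs _ E). unfold filtermap. apply filter_imp. simpl. intros y Hy. rewrite Hy. ring.
Qed.

Lemma slab_diff_continuous (T : Rbar) (g : R -> R -> R) (x t a b : R) :
  slab_diff T g x t a b ->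
  filterlim (fun p => g (fst p) (snd p)) (slab_filter T x t) (locally (g x t)).
Proof.
intros [al [be [La [Lb E]]]].
assert (L : filterlim (fun p => g x t + (al p * (fst p + - x) + be p * (snd p + - t)))
   (slab_filter T x t) (locally (g x t + (a * (x + - x) + b * (t + - t))))).
{ apply filterlim_Rplus; [apply slab_filter_filter|apply filterlim_const|].
  apply filterlim_Rplus; [apply slab_filter_filter| |];
    (apply filterlim_Rmult; [apply slab_filter_filter|assumption|]);
    (apply filterlim_Rplus; [apply slab_filter_filter| |apply filterlim_const]).
  - apply slab_fst.
  - apply slab_snd. }
replace (g x t + (a * (x + - x) + b * (t + - t))) with (g x t) in L by ring.
revert L. apply filterlim_ext_loc. revert E. apply filter_imp. intros p E. lra.
Qed.

Lemma slab_diff_plus (T : Rbar) (g h : R -> R -> R) (x t a b c d : R) :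
  slab_diff T g x t a b -> slab_diff T h x t c d ->
  slab_diff T (fun y r => g y r + h y r) x t (a + c) (b + d).
Proof.
intros [al [be [La [Lb E]]]] [al' [be' [La' [Lb' E']]]].
exists (fun p => al p + al' p), (fun p => be p + be' p). split; [|split].
- apply filterlim_Rplus; auto. apply slab_filter_filter.
- apply filterlim_Rplus; auto. apply slab_filter_filter.
- generalize (filter_and _ _ E E'). apply filter_imp. intros p [A B]. lra.
Qed.

Lemma slab_diff_mult (T : Rbar) (g h : R -> R -> R) (x t a b c d : R) :
  slab_diff T g x t a b -> slab_diff T h x t c d ->
  slab_diff T (fun y r => g y r * h y r) x t (a * h x t + g x t * c) (b * h x t + g x t * d).
Proof.
intros H1 H2. assert (Hc := slab_diff_continuous _ _ _ _ _ _ H2).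
destruct H1 as [al [be [La [Lb E]]]], H2 as [al' [be' [La' [Lb' E']]]].
exists (fun p => al p * h (fst p) (snd p) + g x t * al' p),
  (fun p => be p * h (fst p) (snd p) + g x t * be' p).
assert (FF := slab_filter_filter T x t).
split; [|split].
- apply filterlim_Rplus; [exact FF| |]; apply filterlim_Rmult; auto. apply filterlim_const.
- apply filterlim_Rplus; [exact FF| |]; apply filterlim_Rmult; auto. apply filterlim_const.
- generalize (filter_and _ _ E E'). apply filter_imp. intros p [A B].
  replace (g (fst p) (snd p) * h (fst p) (snd p) - g x t * h x t)
    with ((g (fst p) (snd p) - g x t) * h (fst p) (snd p)
          + g x t * (h (fst p) (snd p) - h x t)) by ring.
  rewrite A, B. ring.
Qed.

Lemma slab_diff_space_fun (T : Rbar) (h : R -> R) (x t a : R) :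
  is_derive h x a -> slab_diff T (fun y _ => h y) x t a 0.
Proof.
intros H. apply is_derive_caratheodory in H. destruct H as [b [L E]].
exists (fun p => b (fst p)), (fun _ => 0). split; [|split].
- exact (filterlim_comp _ _ _ _ _ _ _ _ (slab_fst T x t) L).
- apply filterlim_const.
- generalize (slab_fst T x t _ E). unfold filtermap. apply filter_imp. intros p Hp. lra.
Qed.

(** The slopes of [K] are evaluated along (v(y,r), r), which tends to the base point within the slab
    because [v] is continuous there. Time enters twice, whence the total derivative [d + c * b]. *)
Lemma slab_diff_comp (T : Rbar) (K v : R -> R -> R) (x t a b c d : R) :
  time_dom T t -> slab_diff T v x t a b -> slab_diff T K (v x t) t c d ->
  slab_diff T (fun y r => K (v y r) r) x t (c * a) (d + c * b).
Proof.
intros Ht Hv HK. assert (Hc := slab_diff_continuous _ _ _ _ _ _ Hv).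
destruct Hv as [al [be [La [Lb E]]]], HK as [al' [be' [La' [Lb' E']]]].
assert (FF := slab_filter_filter T x t).
assert (Hl : filterlim (fun p => (v (fst p) (snd p), snd p)) (slab_filter T x t)
               (slab_filter T (v x t) t)).
{ apply filterlim_slab; [exact FF|exact Hc|apply slab_snd|apply slab_filter_dom]. }
exists (fun p => al' (v (fst p) (snd p), snd p) * al p),
  (fun p => be' (v (fst p) (snd p), snd p) + al' (v (fst p) (snd p), snd p) * be p).
assert (L1 := filterlim_comp _ _ _ _ _ _ _ _ Hl La').
assert (L2 := filterlim_comp _ _ _ _ _ _ _ _ Hl Lb').
split; [|split].
- apply filterlim_Rmult; auto.
- apply filterlim_Rplus; [exact FF|exact L2|]. apply filterlim_Rmult; auto.
- generalize (filter_and _ _ E (Hl _ E')). unfold filtermap. apply filter_imp. simpl.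
  intros p [A B]. rewrite B, A. ring.
Qed.

Lemma slab_diff_ext_loc (T : Rbar) (g h : R -> R -> R) (x t a b : R) :
  time_dom T t ->
  slab_filter T x t (fun p => g (fst p) (snd p) = h (fst p) (snd p)) ->
  slab_diff T g x t a b -> slab_diff T h x t a b.
Proof.
intros Ht He [al [be [La [Lb E]]]]. exists al, be. split; [exact La|split; [exact Lb|]].
assert (H0 := slab_filter_at _ _ _ _ Ht He). simpl in H0.
generalize (filter_and _ _ He E). apply filter_imp. intros p [A B]. rewrite <- A, <- H0. exact B.
Qed.

(** * Functions of class C^n on R × [0,T) *)

Lemma C_n_continuous (T : Rbar) (n : nat) (g : R -> R -> R) :
  C_n T n g -> continuous_family T g.
Proof. destruct n; simpl; intros H; apply H. Qed.

(** The increment is split as g(y,r) - g(x,r) plus g(x,r) - g(x,t). The mean value theorem is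
    applied in space, where derivatives are two-sided at all times; the second difference has the
    slope of the one-sided derivative at t. *)
Lemma C_1_slab_diff (T : Rbar) (g : R -> R -> R) (x t : R) :
  C_n T 1 g -> time_dom T t -> slab_diff T g x t (D_space g x t) (D_time T g x t).
Proof.
intros [_ [Hex [[Hcs _] _]]] Ht.
assert (Hds := fun y r Hr => Derive_correct _ _ (proj1 (Hex y r Hr))).
assert (Hdt := Derive_within_correct T _ _ Ht (proj2 (Hex x t Ht))).
apply is_derive_within_caratheodory in Hdt; [|exact Ht].
destruct Hdt as [b [Lb Eb]].
assert (Hmv : forall y r, exists s, time_dom T r ->
   Rabs (s - x) <= Rabs (y - x) /\ g y r - g x r = D_space g s r * (y - x)).
{ intros y r. destruct (classic (time_dom T r)) as [Hr|Hr];
    [|exists 0; intros A; contradiction].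
  destruct (MVT_gen (fun z => g z r) x y (fun z => D_space g z r)) as [s [Hs Es]].
  - intros z _. apply Hds, Hr.
  - intros z _. apply continuity_pt_filterlim.
    apply (ex_derive_continuous (fun z => g z r)). exists (D_space g z r). apply Hds, Hr.
  - exists s. intros _. split; [|exact Es].
    revert Hs. unfold Rmin, Rmax, Rabs. destruct (Rle_dec x y); repeat destruct Rcase_abs; lra. }
(* The intermediate point is chosen as a function of the endpoint; being no farther from x than
   [fst p], it tends to x, and continuity of the space derivative gives the limit of the slope. *)
pose (xi := fun p : R * R => epsilon (inhabits 0) (fun s => time_dom T (snd p) ->
   Rabs (s - x) <= Rabs (fst p - x) /\
   g (fst p) (snd p) - g x (snd p) = D_space g s (snd p) * (fst p - x))).
assert (Hxi : forall p, time_dom T (snd p) -> Rabs (xi p - x) <= Rabs (fst p - x) /\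
   g (fst p) (snd p) - g x (snd p) = D_space g (xi p) (snd p) * (fst p - x)).
{ intros p. exact (epsilon_spec (inhabits 0) _ (Hmv (fst p) (snd p))). }
assert (FF := slab_filter_filter T x t).
assert (Lxi : filterlim xi (slab_filter T x t) (locally x)).
{ apply filterlim_locally. intros e.
  generalize (filter_and _ _ (slab_filter_dom T x t)
    (proj1 (filterlim_locally _ _) (slab_fst T x t) e)).
  apply filter_imp. intros p [A B]. destruct (Hxi p A) as [C _].
  unfold ball in *; simpl in *; unfold AbsRing_ball, abs, minus, plus, opp in *; simpl in *.
  unfold Rminus in C. lra. }
exists (fun p => D_space g (xi p) (snd p)), (fun p => b (snd p)). split; [|split].
- refine (filterlim_comp _ _ _ (fun p => (xi p, snd p)) (fun p => D_space g (fst p) (snd p))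
    _ (slab_filter T x t) _ _ (Hcs x t Ht)).
  apply filterlim_slab; [exact FF|exact Lxi|apply slab_snd|apply slab_filter_dom].
- apply (filterlim_comp _ _ _ snd b _ (within (time_dom T) (locally t))); [|exact Lb].
  intros P HP. generalize (filter_and _ _ (slab_filter_dom T x t) (slab_snd T x t _ HP)).
  unfold filtermap. apply filter_imp. intros p [A B]. exact (B A).
- generalize (filter_and _ _ (slab_filter_dom T x t) (slab_snd T x t _ Eb)).
  unfold filtermap. apply filter_imp. intros p [A B]. specialize (B A).
  destruct (Hxi p A) as [_ C]. lra.
Qed.

Lemma D_space_eq (T : Rbar) (g : R -> R -> R) (x t a b : R) :
  time_dom T t -> slab_diff T g x t a b -> D_space g x t = a.
Proof. intros Ht H. apply is_derive_unique. exact (slab_diff_space T g x t a b Ht H). Qed.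

Lemma D_time_eq (T : Rbar) (g : R -> R -> R) (x t a b : R) :
  time_dom T t -> slab_diff T g x t a b -> D_time T g x t = b.
Proof. intros Ht H. apply Derive_within_unique; [exact Ht|]. exact (slab_diff_time T g x t a b Ht H). Qed.

Lemma continuous_family_ext (T : Rbar) (g h : R -> R -> R) :
  (forall x t, time_dom T t -> g x t = h x t) ->
  continuous_family T g -> continuous_family T h.
Proof.
intros E Hg x t Ht. rewrite <- (E x t Ht).
apply (filterlim_ext_loc (fun p => g (fst p) (snd p))); [|exact (Hg x t Ht)].
generalize (slab_filter_dom T x t). apply filter_imp. intros p Hp. apply E, Hp.
Qed.

Lemma slab_diff_ext (T : Rbar) (g h : R -> R -> R) (x t a b : R) :
  time_dom T t -> (forall y r, time_dom T r -> g y r = h y r) ->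
  slab_diff T g x t a b -> slab_diff T h x t a b.
Proof.
intros Ht E. apply slab_diff_ext_loc; [exact Ht|].
generalize (slab_filter_dom T x t). apply filter_imp. intros p Hp. apply E, Hp.
Qed.

Lemma C_n_S_intro (T : Rbar) (n : nat) (g : R -> R -> R) :
  (forall x t, time_dom T t -> exists a b, slab_diff T g x t a b) ->
  C_n T n (D_space g) -> C_n T n (D_time T g) -> C_n T (S n) g.
Proof.
intros Hd Hs Ht. split; [|split; [|split; assumption]].
- intros x t H. destruct (Hd x t H) as [a [b D]]. exact (slab_diff_continuous T g x t a b D).
- intros x t H. destruct (Hd x t H) as [a [b D]]. split.
  + exists a. exact (slab_diff_space T g x t a b H D).
  + exists b. exact (slab_diff_time T g x t a b H D).
Qed.

Lemma C_1_intro (T : Rbar) (g a b : R -> R -> R) :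
  (forall x t, time_dom T t -> slab_diff T g x t (a x t) (b x t)) ->
  continuous_family T a -> continuous_family T b -> C_n T 1 g.
Proof.
intros Hd Ha Hb. apply C_n_S_intro.
- intros x t Ht. exists (a x t), (b x t). apply Hd, Ht.
- split; [|exact I]. revert Ha. apply continuous_family_ext. intros x t Ht. symmetry.
  exact (D_space_eq T g x t _ _ Ht (Hd x t Ht)).
- split; [|exact I]. revert Hb. apply continuous_family_ext. intros x t Ht. symmetry.
  exact (D_time_eq T g x t _ _ Ht (Hd x t Ht)).
Qed.

Lemma continuous_family_plus (T : Rbar) (g h : R -> R -> R) :
  continuous_family T g -> continuous_family T h ->
  continuous_family T (fun x t => g x t + h x t).
Proof.
intros Hg Hh x t Ht. apply (filterlim_Rplus (slab_filter T x t)).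
- exact (Hg x t Ht).
- exact (Hh x t Ht).
Qed.

Lemma continuous_family_mult (T : Rbar) (g h : R -> R -> R) :
  continuous_family T g -> continuous_family T h ->
  continuous_family T (fun x t => g x t * h x t).
Proof.
intros Hg Hh x t Ht. apply (filterlim_Rmult (slab_filter T x t)).
- exact (Hg x t Ht).
- exact (Hh x t Ht).
Qed.

Lemma continuous_family_opp (T : Rbar) (g : R -> R -> R) :
  continuous_family T g -> continuous_family T (fun x t => - g x t).
Proof. intros Hg x t Ht. apply (filterlim_Ropp (slab_filter T x t)). exact (Hg x t Ht). Qed.

Lemma continuous_family_inv (T : Rbar) (g : R -> R -> R) :
  (forall x t, time_dom T t -> g x t <> 0) ->
  continuous_family T g -> continuous_family T (fun x t => / g x t).
Proof.
intros Hn Hg x t Ht. apply (filterlim_Rinv (slab_filter T x t)); [exact (Hn x t Ht)|].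
exact (Hg x t Ht).
Qed.

Lemma continuous_family_space (T : Rbar) (h : R -> R) :
  (forall x, continuous h x) -> continuous_family T (fun x _ => h x).
Proof. intros H x t _. exact (slab_fst_fun T h x t (H x)). Qed.

(** * Mixed derivatives and constancy in time, up to t = 0 *)

Lemma D_time_interior (T : Rbar) (g : R -> R -> R) (x t : R) :
  time_dom T t -> 0 < t -> ex_derive_within (time_dom T) (g x) t ->
  D_time T g x t = Derive (g x) t /\ ex_derive (g x) t.
Proof.
intros Ht Hp He. assert (H := Derive_within_correct T _ _ Ht He).
apply is_derive_within_interior in H; [|exact Ht|exact Hp]. split.
- symmetry. exact (is_derive_unique _ _ _ H).
- exists (Derive_within (time_dom T) (g x) t). exact H.
Qed.

Lemma slab_filter_interior (T : Rbar) (x t : R) :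
  time_dom T t -> 0 < t ->
  locally (x, t) (fun p : R * R => time_dom T (snd p) /\ 0 < snd p).
Proof.
intros Ht Hp.
destruct (filter_and _ _ (time_dom_interior T t Ht Hp) (open_gt 0 t Hp)) as [e He].
exists e. intros p [_ H]. exact (He _ H).
Qed.

Lemma continuous_family_interior (T : Rbar) (g : R -> R -> R) (x t : R) :
  continuous_family T g -> time_dom T t -> 0 < t ->
  filterlim (fun p => g (fst p) (snd p)) (locally (x, t)) (locally (g x t)).
Proof.
intros Hg Ht Hp P HP. assert (H := Hg x t Ht P HP).
unfold filtermap, within in *.
generalize (filter_and _ _ H (slab_filter_interior T x t Ht Hp)).
apply filter_imp. intros p [A [B _]]. exact (A B).
Qed.

(** Around an interior time [D_time] is the ordinary derivative on a whole neighbourhood, so both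
    iterated derivatives become those of Schwarz's theorem. *)
Lemma D_time_D_space_interior (T : Rbar) (g : R -> R -> R) (x t : R) :
  C_n T 2 g -> time_dom T t -> 0 < t ->
  D_time T (D_space g) x t = D_space (D_time T g) x t.
Proof.
intros [_ [Hex [[_ [Hexs [_ [Hst _]]]] [_ [Hext [[Hts _] _]]]]]] Ht Hp.
assert (E1 : forall y r, time_dom T r -> 0 < r ->
   Derive (fun z => Derive (fun q => g z q) r) y = D_space (D_time T g) y r).
{ intros y r Hr Hr'. apply Derive_ext. intros z. symmetry.
  apply D_time_interior; auto. apply Hex, Hr. }
assert (E2 : forall y r, time_dom T r -> 0 < r ->
   Derive (fun z => Derive (fun q => g q z) y) r = D_time T (D_space g) y r).
{ intros y r Hr Hr'. symmetry. apply (D_time_interior T (D_space g)); auto. apply Hexs, Hr. }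
assert (Hin := slab_filter_interior T x t Ht Hp).
rewrite <- E1, <- E2 by assumption. symmetry. apply Schwarz.
- apply locally_2d_locally. revert Hin. apply filter_imp. intros [y r] [Hr Hr']; simpl in *.
  split; [|split; [|split]].
  + apply Hex, Hr.
  + apply (D_time_interior T g); auto. apply Hex, Hr.
  + apply (ex_derive_ext (fun z => D_time T g z r)); [|apply Hext, Hr].
    intros z. apply D_time_interior; auto. apply Hex, Hr.
  + apply (D_time_interior T (D_space g)); auto. apply Hexs, Hr.
- apply continuity_2d_pt_filterlim. rewrite E1 by assumption.
  apply (filterlim_ext_loc (fun p => D_space (D_time T g) (fst p) (snd p)));
    [|exact (continuous_family_interior T _ x t Hts Ht Hp)].
  revert Hin. apply filter_imp. intros p [A B]. symmetry. apply E1; assumption.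
- apply continuity_2d_pt_filterlim. rewrite E2 by assumption.
  apply (filterlim_ext_loc (fun p => D_time T (D_space g) (fst p) (snd p)));
    [|exact (continuous_family_interior T _ x t Hst Ht Hp)].
  revert Hin. apply filter_imp. intros p [A B]. symmetry. apply E2; assumption.
Qed.

(** At t = 0 both mixed derivatives are continuous up to the boundary and agree for positive times,
    so their limits from the right coincide. *)
Lemma D_time_D_space (T : Rbar) (g : R -> R -> R) (x t : R) :
  C_n T 2 g -> time_dom T t -> D_time T (D_space g) x t = D_space (D_time T g) x t.
Proof.
intros Hg Ht. destruct (Rle_lt_or_eq_dec 0 t (proj1 Ht)) as [Hp|E];
  [exact (D_time_D_space_interior T g x t Hg Ht Hp)|].
assert (Hle := at_right_le_time T t Ht).
assert (Hs := slab_time_slice T x t Ht).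
assert (Hst : continuous_family T (D_time T (D_space g))) by apply Hg.
assert (Hts : continuous_family T (D_space (D_time T g))) by apply Hg.
assert (L1 := filterlim_filter_le_1 _ Hle (filterlim_comp _ _ _ _ _ _ _ _ Hs (Hst x t Ht))).
assert (L2 := filterlim_filter_le_1 _ Hle (filterlim_comp _ _ _ _ _ _ _ _ Hs (Hts x t Ht))).
apply (filterlim_locally_unique (K := R_AbsRing) (V := R_NormedModule) (F := at_right t) _ _ _ L1).
revert L2. apply filterlim_ext_loc.
assert (Hd : at_right t (time_dom T)).
{ apply Hle. unfold within. apply filter_forall. auto. }
assert (Hr : at_right t (fun r => t < r)) by (unfold at_right, within; apply filter_forall; auto).
generalize (filter_and _ _ Hd Hr). apply filter_imp. simpl. intros r [A B]. symmetry.
apply D_time_D_space_interior; [exact Hg|exact A|lra].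
Qed.

Lemma is_derive_within_continuous (T : Rbar) (phi : R -> R) (t l : R) :
  time_dom T t -> is_derive_within (time_dom T) phi t l ->
  filterlim phi (within (time_dom T) (locally t)) (locally (phi t)).
Proof.
intros Ht H. apply is_derive_within_caratheodory in H; [|exact Ht].
destruct H as [b [L E]].
assert (FF : Filter (within (time_dom T) (locally t))) by apply within_filter, locally_filter.
assert (L' : filterlim (fun r => phi t + b r * (r + - t)) (within (time_dom T) (locally t))
   (locally (phi t + l * (t + - t)))).
{ apply filterlim_Rplus; [exact FF|apply filterlim_const|].
  apply filterlim_Rmult; [exact FF|exact L|].
  apply filterlim_Rplus; [exact FF|apply within_is_filter_lim|apply filterlim_const]. }
replace (phi t + l * (t + - t)) with (phi t) in L' by ring.
revert L'. apply filterlim_ext_loc. revert E. apply filter_imp. intros r Hr. lra.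
Qed.

Lemma time_dom_le (T : Rbar) (t r : R) : time_dom T t -> 0 <= r <= t -> time_dom T r.
Proof. intros [H1 H2] H. split; [apply H|]. destruct T; simpl in *; auto; lra. Qed.

(** Two-sided derivatives give constancy on (0,t] only; the value at 0 is recovered as the limit
    from the right. *)
Lemma time_constant (T : Rbar) (phi : R -> R) (t : R) :
  (forall r, time_dom T r -> is_derive_within (time_dom T) phi r 0) ->
  time_dom T t -> phi t = phi 0.
Proof.
intros H Ht. destruct (Rle_lt_or_eq_dec 0 t (proj1 Ht)) as [Hp|E]; [|rewrite <- E; reflexivity].
assert (H0 : time_dom T 0) by (apply (time_dom_le T t); [exact Ht|lra]).
assert (L := filterlim_filter_le_1 _ (at_right_le_time T 0 H0)
  (is_derive_within_continuous T phi 0 0 H0 (H 0 H0))).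
apply (filterlim_locally_unique (K := R_AbsRing) (V := R_NormedModule) (F := at_right 0) phi);
  [|exact L].
apply (filterlim_ext_loc (fun _ => phi t)); [|apply filterlim_const].
unfold at_right, within. generalize (open_lt t 0 Hp). apply filter_imp. intros r Hr Hr'.
symmetry. apply (eq_is_derive phi); [|exact Hr]. intros q Hq.
assert (Hdq : time_dom T q) by (apply (time_dom_le T t); [exact Ht|lra]).
apply (is_derive_within_interior T); [exact Hdq|lra|exact (H q Hdq)].
Qed.

(** * Plane curves and their normal angle *)

Lemma periodic_IZR {V : Type} (g : R -> V) (m : Z) (u : R) :
  periodic g -> g (u + IZR m * (2 * PI)) = g u.
Proof.
intros Hg.
assert (Hn : forall (n : nat) v, g (v + INR n * (2 * PI)) = g v).
{ induction n as [|n IH]; intros v.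
  - simpl. f_equal. ring.
  - rewrite S_INR. replace (v + (INR n + 1) * (2 * PI)) with ((v + INR n * (2 * PI)) + 2 * PI) by ring.
    rewrite Hg. apply IH. }
destruct (Z_le_gt_dec 0 m) as [Hm|Hm].
- rewrite <- (Z2Nat.id m Hm), <- INR_IZR_INZ. apply Hn.
- rewrite <- (Hn (Z.to_nat (- m)) (u + IZR m * (2 * PI))).
  rewrite INR_IZR_INZ, Z2Nat.id, opp_IZR by lia. f_equal. ring.
Qed.

Lemma mod_2PI (u a : R) : exists m : Z, a <= u + IZR m * (2 * PI) < a + 2 * PI.
Proof.
assert (Hpi := PI_RGT_0).
(* Since [up q] exceeds q by at most 1, the integer [1 - up q] is minus the floor of q. *)
exists (1 - up ((u - a) / (2 * PI)))%Z. rewrite minus_IZR.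
destruct (archimed ((u - a) / (2 * PI))) as [H1 H2].
set (q := IZR (up ((u - a) / (2 * PI)))) in *.
assert (E : u - a = ((u - a) / (2 * PI)) * (2 * PI)) by (field; lra).
set (z := (u - a) / (2 * PI)) in *.
assert (0 < (q - z) * (2 * PI)) by (apply Rmult_lt_0_compat; lra).
assert (0 <= (1 - (q - z)) * (2 * PI)) by (apply Rmult_le_pos; lra).
split; lra.
Qed.

Lemma IZR_2PI_small (m : Z) : Rabs (IZR m * (2 * PI)) < 2 * PI -> m = 0%Z.
Proof.
intros H. assert (Hpi := PI_RGT_0).
rewrite Rabs_mult, (Rabs_pos_eq (2 * PI)) in H by lra.
assert (H' : Rabs (IZR m) < 1) by (apply Rmult_lt_reg_r with (2 * PI); lra).
rewrite <- abs_IZR in H'. apply lt_IZR in H'. lia.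
Qed.

Lemma speed_sqr (c : R -> R * R) (u : R) :
  speed c u * speed c u =
  fst (vDerive c u) * fst (vDerive c u) + snd (vDerive c u) * snd (vDerive c u).
Proof. unfold speed. apply sqrt_sqrt. unfold dot. nra. Qed.

Lemma speed_pos (c : R -> R * R) (u : R) : vDerive c u <> (0, 0) -> 0 < speed c u.
Proof.
intros H. apply sqrt_lt_R0. unfold dot.
destruct (vDerive c u) as [a b]; simpl.
destruct (Req_dec a 0) as [Ha|Ha]; [|nra].
destruct (Req_dec b 0) as [Hb|Hb]; [subst; exfalso; auto|nra].
Qed.

Lemma inner_normal_eq (c : R -> R * R) (u : R) :
  inner_normal c u =
  (- (/ speed c u * snd (vDerive c u)), / speed c u * fst (vDerive c u)).
Proof. reflexivity. Qed.

Lemma orthogonal_rotation (a b theta : R) :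
  a * cos theta + b * sin theta = 0 ->
  let s := - a * sin theta + b * cos theta in
  a = - (s * sin theta) /\ b = s * cos theta.
Proof.
intros E s. assert (Hcs := sin2_cos2 theta). unfold Rsqr in Hcs. unfold s. split.
- transitivity (a * (sin theta * sin theta + cos theta * cos theta)); [rewrite Hcs; ring|].
  transitivity (cos theta * (a * cos theta + b * sin theta)
    - (- a * sin theta + b * cos theta) * sin theta); [ring|rewrite E; ring].
- transitivity (b * (sin theta * sin theta + cos theta * cos theta)); [rewrite Hcs; ring|].
  transitivity (sin theta * (a * cos theta + b * sin theta)
    + (- a * sin theta + b * cos theta) * cos theta); [ring|rewrite E; ring].
Qed.

(** This removes the square root from the condition: what remains is an equation, accessible to the
    intermediate value theorem and to implicit differentiation, and an open sign condition that
    tells the outer normal from its opposite. *)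
Lemma inner_normal_iff (c : R -> R * R) (u theta : R) :
  vDerive c u <> (0, 0) ->
  inner_normal c u = (- cos theta, - sin theta) <->
  fst (vDerive c u) * cos theta + snd (vDerive c u) * sin theta = 0 /\
  0 < - fst (vDerive c u) * sin theta + snd (vDerive c u) * cos theta.
Proof.
intros H0. rewrite inner_normal_eq.
assert (Hg := speed_pos c u H0). assert (Hg2 := speed_sqr c u).
set (g := speed c u) in *. set (a := fst (vDerive c u)) in *. set (b := snd (vDerive c u)) in *.
assert (Hcs := sin2_cos2 theta). unfold Rsqr in Hcs.
split.
- intros E. injection E as E1 E2.
  assert (Hb : b = g * cos theta).
  { replace b with (g * (/ g * b)) by (field; lra). replace (/ g * b) with (cos theta) by lra. ring. }
  assert (Ha : a = - (g * sin theta)).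
  { replace a with (g * (/ g * a)) by (field; lra). rewrite E2. ring. }
  rewrite Ha, Hb. split; [ring|].
  replace (- - (g * sin theta) * sin theta + g * cos theta * cos theta) with g; [exact Hg|].
  transitivity (g * (sin theta * sin theta + cos theta * cos theta)); [rewrite Hcs|]; ring.
- intros [E1 E2]. set (s := - a * sin theta + b * cos theta) in *.
  destruct (orthogonal_rotation a b theta E1) as [Ha Hb]. fold s in Ha, Hb.
  assert (Hs : g = s).
  { assert (g * g = s * s).
    { rewrite Hg2. rewrite Ha at 1 2. rewrite Hb at 1 2.
      transitivity (s * s * (sin theta * sin theta + cos theta * cos theta)); [ring|rewrite Hcs; ring]. }
    nra. }
  rewrite Ha, Hb, Hs. f_equal; field; lra.
Qed.

(* The outer normal angle is theta where the height function u |-> <c(u), (cos theta, sin theta)>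
   is maximal. *)
Lemma normal_param_exists (c : R -> R * R) (theta : R) :
  periodic c -> strictly_convex c ->
  (forall u, ex_derive (fun v => fst (c v)) u) -> (forall u, ex_derive (fun v => snd (c v)) u) ->
  exists u, inner_normal c u = (- cos theta, - sin theta).
Proof.
intros Hper [H0 [Hconv _]] Hx Hy.
pose (phi := fun u => fst (c u) * cos theta + snd (c u) * sin theta).
assert (Hpi := PI_RGT_0).
assert (Hd : forall u, is_derive phi u
   (fst (vDerive c u) * cos theta + snd (vDerive c u) * sin theta)).
{ intros u. unfold phi.
  apply (is_derive_plus (K := R_AbsRing) (V := R_NormedModule)).
  - apply (is_derive_ext (fun v => scal (fst (c v)) (cos theta))); [reflexivity|].
    exact (is_derive_scal_l (fun v => fst (c v)) u _ (cos theta) (Derive_correct _ _ (Hx u))).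
  - exact (is_derive_scal_l (fun v => snd (c v)) u _ (sin theta) (Derive_correct _ _ (Hy u))). }
destruct (continuity_ab_maj phi 0 (2 * PI)) as [M [HM _]]; [lra| |].
{ intros u _. apply continuity_pt_filterlim. apply (ex_derive_continuous phi). eexists; apply Hd. }
assert (HM' : forall u, phi u <= phi M).
{ intros u. destruct (mod_2PI u 0) as [m Hm].
  unfold phi at 1. rewrite <- (periodic_IZR c m u Hper). apply HM. lra. }
exists M. apply inner_normal_iff; [apply H0|].
assert (E : fst (vDerive c M) * cos theta + snd (vDerive c M) * sin theta = 0).
{ assert (Hd' := proj1 (is_derive_Reals _ _ _) (Hd M)).
  rewrite <- (derive_pt_eq_0 phi M _ (exist _ _ Hd') Hd').
  apply (deriv_maximum phi (M - 1) (M + 1)); try lra. intros; apply HM'. }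
split; [exact E|].
(* The equation leaves the orientation open. A second point of the curve decides it: it lies
   strictly on the inner side of the tangent at [M], and its height is at most the maximum, which is
   impossible when [s] is not positive. The parameter M + π is a convenient one not congruent to
   [M]. *)
assert (Hc := Hconv M (M + PI)). rewrite inner_normal_eq in Hc.
assert (Hg := speed_pos c M (H0 M)).
specialize (HM' (M + PI)). unfold phi in HM'.
remember (fst (vDerive c M)) as a eqn:Da. remember (snd (vDerive c M)) as b eqn:Db.
clear Da Db.
unfold dot, minus, plus, opp in Hc; simpl in Hc; unfold plus, opp in Hc; simpl in Hc.
set (g := speed c M) in *.
set (dx := fst (c (M + PI))) in *. set (dy := snd (c (M + PI))) in *.
assert (Hc' : 0 < (dx + - fst (c M)) * - (/ g * b) + (dy + - snd (c M)) * (/ g * a)).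
{ apply Hc. intros m Em.
  assert (E1 : IZR (2 * m) * PI = 1 * PI) by (rewrite mult_IZR; lra).
  apply Rmult_eq_reg_r in E1; [|lra]. apply eq_IZR in E1. lia. }
clear Hc. set (s := - a * sin theta + b * cos theta).
destruct (orthogonal_rotation a b theta E) as [Ha Hb]. fold s in Ha, Hb.
destruct (Rlt_le_dec 0 s) as [Hs|Hs]; [exact Hs|exfalso].
assert (Hi := Rinv_0_lt_compat g Hg).
replace ((dx + - fst (c M)) * - (/ g * b) + (dy + - snd (c M)) * (/ g * a))
  with (/ g * (s * (fst (c M) * cos theta + snd (c M) * sin theta - (dx * cos theta + dy * sin theta)))) in Hc'
  by (rewrite Ha, Hb; ring).
assert (s * (fst (c M) * cos theta + snd (c M) * sin theta - (dx * cos theta + dy * sin theta)) <= 0) by nra.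
nra.
Qed.

(** With a common normal, each of two distinct points would lie strictly on the inner side of the
    tangent at the other, so a number and its opposite would both be positive. *)
Lemma inner_normal_injective (c : R -> R * R) (u v : R) :
  strictly_convex c -> inner_normal c u = inner_normal c v ->
  exists m : Z, v = u + IZR m * (2 * PI).
Proof.
intros [_ [Hconv _]] E. apply NNPP. intros Hn.
assert (A := Hconv u v). assert (B := Hconv v u). rewrite E in A.
assert (A' : 0 < dot (minus (c v) (c u)) (inner_normal c v)).
{ apply A. intros m Hm. apply Hn. exists m. exact Hm. }
assert (B' : 0 < dot (minus (c u) (c v)) (inner_normal c v)).
{ apply B. intros m Hm. apply Hn. exists (- m)%Z. rewrite opp_IZR. lra. }
unfold dot, minus, plus, opp in A', B'; simpl in A', B'; unfold plus, opp in A', B'; simpl in A', B'.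
lra.
Qed.

(** The classical k |c'|^3 = det(c', c''). The derivative of the factor 1/|c'| in the unit tangent
    multiplies c', which is orthogonal to the normal, and so drops out. *)
Lemma curvature_eq (c : R -> R * R) (u a b : R) :
  vDerive c u <> (0, 0) ->
  is_derive (fun v => fst (vDerive c v)) u a ->
  is_derive (fun v => snd (vDerive c v)) u b ->
  curvature c u * (speed c u * speed c u * speed c u) =
  b * fst (vDerive c u) - a * snd (vDerive c u).
Proof.
intros H0 Ha Hb. assert (Hg := speed_pos c u H0).
set (x := fst (vDerive c u)) in *. set (y := snd (vDerive c u)) in *.
assert (Hsp : is_derive (speed c) u ((a * x + x * a + (b * y + y * b)) / (2 * speed c u))).
{ assert (Hq : 0 < dot (vDerive c u) (vDerive c u)).
  { assert (E := speed_sqr c u). unfold dot. rewrite <- E. nra. }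
  refine (is_derive_sqrt (fun v => dot (vDerive c v) (vDerive c v)) u _ _ Hq).
  unfold dot. apply (is_derive_plus (K := R_AbsRing) (V := R_NormedModule)).
  - exact (is_derive_mult _ _ u a a Ha Ha Rmult_comm).
  - exact (is_derive_mult _ _ u b b Hb Hb Rmult_comm). }
assert (Hinv := is_derive_inv (speed c) u _ Hsp (Rgt_not_eq _ _ Hg)).
set (g' := (a * x + x * a + (b * y + y * b)) / (2 * speed c u)) in *.
assert (D1 : Derive (fun v => fst (unit_tangent c v)) u = (- g' / speed c u ^ 2) * x + / speed c u * a).
{ apply is_derive_unique. exact (is_derive_mult _ _ u _ a Hinv Ha Rmult_comm). }
assert (D2 : Derive (fun v => snd (unit_tangent c v)) u = (- g' / speed c u ^ 2) * y + / speed c u * b).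
{ apply is_derive_unique. exact (is_derive_mult _ _ u _ b Hinv Hb Rmult_comm). }
unfold curvature, D_arclength, vDerive at 1.
rewrite D1, D2, inner_normal_eq. fold x y.
unfold dot, scal; simpl. unfold mult; simpl. unfold scal; simpl; unfold mult; simpl.
field. lra.
Qed.

(** * The parameter of given normal angle *)

(** A class stable under both partial derivatives, which is why all orders are required at once.
    Periodicity makes the value at a parameter of given normal angle independent of the chosen
    representative. *)
Definition closed_smooth (T : Rbar) (K : R -> R -> R) : Prop :=
  (forall n, C_n T n K) /\ (forall t, time_dom T t -> periodic (fun u => K u t)).

Lemma closed_smooth_D_space (T : Rbar) (K : R -> R -> R) :
  closed_smooth T K -> closed_smooth T (D_space K).
Proof.
intros [HK Hp]. split.
- intros n. apply (HK (S n)).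
- intros t Ht u. apply is_derive_unique.
  apply (is_derive_ext (fun y => K (y + - (2 * PI)) t)).
  { intros y. rewrite <- (Hp t Ht (y + - (2 * PI))). f_equal. ring. }
  assert (H : is_derive (fun y => K y t) (u + 2 * PI + - (2 * PI)) (D_space K u t)).
  { replace (u + 2 * PI + - (2 * PI)) with u by ring. apply Derive_correct, (HK 1%nat), Ht. }
  assert (H' : is_derive (fun y : R => y + - (2 * PI)) (u + 2 * PI) 1) by (auto_derive; trivial).
  replace (D_space K u t) with (scal 1 (D_space K u t)) by (unfold scal; simpl; unfold mult; simpl; ring).
  exact (is_derive_comp (fun y => K y t) (fun y => y + - (2 * PI)) _ _ _ H H').
Qed.

Lemma closed_smooth_D_time (T : Rbar) (K : R -> R -> R) :
  closed_smooth T K -> closed_smooth T (D_time T K).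
Proof.
intros [HK Hp]. split.
- intros n. apply (HK (S n)).
- intros t Ht u. apply Derive_within_unique; [exact Ht|].
  apply (is_derive_within_ext T (K u)); [exact Ht| |].
  + intros r Hr. symmetry. exact (Hp r Hr u).
  + apply Derive_within_correct; [exact Ht|]. apply (HK 1%nat), Ht.
Qed.

Definition xcoord (F : R -> R -> R * R) (u t : R) : R := fst (F u t).
Definition ycoord (F : R -> R -> R * R) (u t : R) : R := snd (F u t).

Record convex_evolution (T : Rbar) (F : R -> R -> R * R) : Prop := {
  evolution_closed : forall t, time_dom T t -> periodic (fun u => F u t);
  evolution_smooth : smooth_family T F;
  evolution_convex : forall t, time_dom T t -> strictly_convex (fun u => F u t)
}.

Lemma closed_smooth_xcoord (T : Rbar) (F : R -> R -> R * R) :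
  convex_evolution T F -> closed_smooth T (xcoord F).
Proof.
intros [Hp Hs _]. split.
- intros n. apply Hs.
- intros t Ht u. exact (f_equal fst (Hp t Ht u)).
Qed.

Lemma closed_smooth_ycoord (T : Rbar) (F : R -> R -> R * R) :
  convex_evolution T F -> closed_smooth T (ycoord F).
Proof.
intros [Hp Hs _]. split.
- intros n. apply Hs.
- intros t Ht u. exact (f_equal snd (Hp t Ht u)).
Qed.

Definition angle_param (F : R -> R -> R * R) (theta t : R) : R :=
  normal_param (fun u => F u t) theta.

Definition at_angle (F : R -> R -> R * R) (K : R -> R -> R) (theta t : R) : R :=
  K (angle_param F theta t) t.

Lemma ex_derive_space (T : Rbar) (K : R -> R -> R) (u t : R) :
  closed_smooth T K -> time_dom T t -> ex_derive (fun v => K v t) u.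
Proof. intros [HK _] Ht. apply (HK 1%nat), Ht. Qed.

Lemma angle_param_normal (T : Rbar) (F : R -> R -> R * R) (theta t : R) :
  convex_evolution T F -> time_dom T t ->
  inner_normal (fun u => F u t) (angle_param F theta t) = (- cos theta, - sin theta).
Proof.
intros HF Ht. unfold angle_param, normal_param. apply epsilon_spec.
apply normal_param_exists.
- exact (evolution_closed _ _ HF t Ht).
- exact (evolution_convex _ _ HF t Ht).
- intros u. exact (ex_derive_space T (xcoord F) u t (closed_smooth_xcoord T F HF) Ht).
- intros u. exact (ex_derive_space T (ycoord F) u t (closed_smooth_ycoord T F HF) Ht).
Qed.

Lemma angle_param_spec (T : Rbar) (F : R -> R -> R * R) (theta t : R) :
  convex_evolution T F -> time_dom T t ->
  at_angle F (D_space (xcoord F)) theta t * cos theta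
    + at_angle F (D_space (ycoord F)) theta t * sin theta = 0 /\
  0 < - at_angle F (D_space (xcoord F)) theta t * sin theta
    + at_angle F (D_space (ycoord F)) theta t * cos theta.
Proof.
intros HF Ht.
apply (inner_normal_iff (fun u => F u t) (angle_param F theta t) theta).
- apply (evolution_convex _ _ HF t Ht).
- exact (angle_param_normal T F theta t HF Ht).
Qed.

Lemma angle_param_unique (T : Rbar) (F : R -> R -> R * R) (theta t u : R) :
  convex_evolution T F -> time_dom T t ->
  D_space (xcoord F) u t * cos theta + D_space (ycoord F) u t * sin theta = 0 ->
  0 < - D_space (xcoord F) u t * sin theta + D_space (ycoord F) u t * cos theta ->
  exists m : Z, angle_param F theta t = u + IZR m * (2 * PI).
Proof.
intros HF Ht H1 H2. apply (inner_normal_injective (fun u => F u t)).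
- exact (evolution_convex _ _ HF t Ht).
- rewrite (angle_param_normal T F theta t HF Ht).
  apply (inner_normal_iff (fun u => F u t)); [apply (evolution_convex _ _ HF t Ht)|].
  split; assumption.
Qed.

(** The u-derivative of <F_u, n> at w: the denominator of the implicit differentiation, whose sign
    makes the zero simple. *)
Definition bend (F : R -> R -> R * R) (theta t : R) : R :=
  at_angle F (D_space (D_space (xcoord F))) theta t * cos theta
  + at_angle F (D_space (D_space (ycoord F))) theta t * sin theta.

Lemma tangent_at_angle (T : Rbar) (F : R -> R -> R * R) (theta t : R) :
  convex_evolution T F -> time_dom T t ->
  let g := speed (fun u => F u t) (angle_param F theta t) in
  0 < g /\
  at_angle F (D_space (xcoord F)) theta t = - g * sin theta /\
  at_angle F (D_space (ycoord F)) theta t = g * cos theta.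
Proof.
intros HF Ht g.
assert (Hg : 0 < g) by (apply speed_pos, (evolution_convex _ _ HF t Ht)).
assert (E := angle_param_normal T F theta t HF Ht).
rewrite inner_normal_eq in E. injection E as E1 E2. fold g in E1, E2.
change (Derive (fun v : R => fst (F v t)) (angle_param F theta t))
  with (at_angle F (D_space (xcoord F)) theta t) in E2.
change (Derive (fun v : R => snd (F v t)) (angle_param F theta t))
  with (at_angle F (D_space (ycoord F)) theta t) in E1.
split; [exact Hg|split].
- apply Rmult_eq_reg_l with (/ g); [|apply Rinv_neq_0_compat; lra]. rewrite E2. field. lra.
- apply Rmult_eq_reg_l with (/ g); [|apply Rinv_neq_0_compat; lra].
  apply Ropp_eq_reg. rewrite E1. field. lra.
Qed.

(** At w the vector F_u is g (- sin theta, cos theta), so det(F_u, F_uu) = - g <F_uu, n>; by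
    [curvature_eq] the left side is k g^3, and one factor g cancels. *)
Lemma bend_curvature (T : Rbar) (F : R -> R -> R * R) (theta t : R) :
  convex_evolution T F -> time_dom T t ->
  let u := angle_param F theta t in
  bend F theta t =
  - (curvature (fun v => F v t) u * (speed (fun v => F v t) u * speed (fun v => F v t) u)).
Proof.
intros HF Ht u.
assert (Hx := closed_smooth_D_space _ _ (closed_smooth_xcoord T F HF)).
assert (Hy := closed_smooth_D_space _ _ (closed_smooth_ycoord T F HF)).
destruct (tangent_at_angle T F theta t HF Ht) as [Hg [E1 E2]]. fold u in Hg, E1, E2.
assert (Hk := curvature_eq (fun v => F v t) u _ _ (proj1 (evolution_convex _ _ HF t Ht) u)
  (Derive_correct _ _ (ex_derive_space T _ u t Hx Ht))
  (Derive_correct _ _ (ex_derive_space T _ u t Hy Ht))).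
change (fst (vDerive (fun v => F v t) u)) with (at_angle F (D_space (xcoord F)) theta t) in Hk.
change (snd (vDerive (fun v => F v t) u)) with (at_angle F (D_space (ycoord F)) theta t) in Hk.
rewrite E1, E2 in Hk. unfold bend.
set (g := speed _ _) in *.
assert (Hk' : curvature (fun v => F v t) u * (g * g * g) =
  at_angle F (D_space (D_space (ycoord F))) theta t * (- g * sin theta)
  - at_angle F (D_space (D_space (xcoord F))) theta t * (g * cos theta)) by exact Hk.
apply Rmult_eq_reg_r with g; [|lra].
transitivity (- (curvature (fun v : R => F v t) u * (g * g * g))); [|ring].
rewrite Hk'. ring.
Qed.

Lemma bend_neg (T : Rbar) (F : R -> R -> R * R) (theta t : R) :
  convex_evolution T F -> time_dom T t -> bend F theta t < 0.
Proof.
intros HF Ht. rewrite (bend_curvature T) by assumption.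
destruct (tangent_at_angle T F theta t HF Ht) as [Hg _].
assert (Hk := proj2 (proj2 (evolution_convex _ _ HF t Ht)) (angle_param F theta t)).
set (g := speed _ _) in *. set (k := curvature _ _) in *.
assert (0 < k * (g * g)) by (apply Rmult_lt_0_compat; [exact Hk|nra]). lra.
Qed.

Lemma closed_smooth_shift (T : Rbar) (K : R -> R -> R) (m : Z) (u t : R) :
  closed_smooth T K -> time_dom T t -> K (u + IZR m * (2 * PI)) t = K u t.
Proof. intros [_ Hp] Ht. exact (periodic_IZR (fun u => K u t) m u (Hp t Ht)). Qed.

Lemma filter_prod_extract (T : Rbar) (th u t : R) (P : R * (R * R) -> Prop) :
  filter_prod (locally th) (slab_filter T u t) P ->
  exists d : posreal, forall th' u' t', Rabs (th' - th) < d -> Rabs (u' - u) < d ->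
    Rabs (t' - t) < d -> time_dom T t' -> P (th', (u', t')).
Proof.
intros [Q R' [d1 H1] [d2 H2] H].
assert (Hm : 0 < Rmin d1 d2) by (apply Rmin_pos; apply cond_pos).
exists (mkposreal _ Hm). simpl. intros th' u' t' A B C D.
assert (M1 := Rmin_l d1 d2). assert (M2 := Rmin_r d1 d2).
apply H.
- apply H1. unfold ball; simpl; unfold AbsRing_ball, abs, minus, plus, opp; simpl.
  unfold Rminus in A. lra.
- apply H2; [|exact D].
  split; unfold ball; simpl; unfold AbsRing_ball, abs, minus, plus, opp; simpl;
    unfold Rminus in B, C; lra.
Qed.

(* [angle_param] is only determined up to multiples of 2 PI, so it need not be continuous;
   its representative closest to a base value is, because the defining equation
   <F_u, (cos theta, sin theta)> = 0 has a simple zero there (intermediate value theorem). *)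
Lemma angle_selection (T : Rbar) (F : R -> R -> R * R) (theta0 t0 : R) :
  convex_evolution T F -> time_dom T t0 ->
  exists v : R -> R -> R,
    v theta0 t0 = angle_param F theta0 t0 /\
    (forall theta t, exists m : Z, v theta t = angle_param F theta t + IZR m * (2 * PI)) /\
    filterlim (fun p => v (fst p) (snd p)) (slab_filter T theta0 t0) (locally (v theta0 t0)).
Proof.
intros HF Ht0. set (u0 := angle_param F theta0 t0).
assert (Hpi := PI_RGT_0).
assert (Hm : forall theta t, exists m : Z,
   u0 - PI <= angle_param F theta t + IZR m * (2 * PI) < u0 + PI).
{ intros theta t. destruct (mod_2PI (angle_param F theta t) (u0 - PI)) as [m H].
  exists m. lra. }
pose (m := fun theta t => epsilon (inhabits 0%Z) (fun m : Z =>
   u0 - PI <= angle_param F theta t + IZR m * (2 * PI) < u0 + PI)).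
assert (Hm' : forall theta t, u0 - PI <= angle_param F theta t + IZR (m theta t) * (2 * PI) < u0 + PI).
{ intros theta t. exact (epsilon_spec (inhabits 0%Z) _ (Hm theta t)). }
exists (fun theta t => angle_param F theta t + IZR (m theta t) * (2 * PI)).
assert (E0 : angle_param F theta0 t0 + IZR (m theta0 t0) * (2 * PI) = u0).
{ assert (H := Hm' theta0 t0). fold u0 in H. fold u0.
  rewrite (IZR_2PI_small (m theta0 t0)) by (apply Rabs_def1; lra). ring. }
rewrite E0. split; [reflexivity|split; [intros theta t; exists (m theta t); reflexivity|]].
assert (Hx := closed_smooth_D_space _ _ (closed_smooth_xcoord T F HF)).
assert (Hy := closed_smooth_D_space _ _ (closed_smooth_ycoord T F HF)).
set (A := D_space (xcoord F)) in *. set (B := D_space (ycoord F)) in *.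
destruct (angle_param_spec T F theta0 t0 HF Ht0) as [G0 H0].
assert (Hb := bend_neg T F theta0 t0 HF Ht0). unfold bend in Hb.
unfold at_angle in G0, H0, Hb. fold A B u0 in G0, H0, Hb.
assert (CA := fun u t => C_n_continuous T 0 A (proj1 Hx 0%nat) u t).
assert (CB := fun u t => C_n_continuous T 0 B (proj1 Hy 0%nat) u t).
assert (FP : Filter (filter_prod (locally theta0) (slab_filter T u0 t0))) 
  by (apply filter_prod_filter; [apply locally_filter|apply slab_filter_filter]).
(* the tangent keeps its orientation near the base point *)
assert (LH : filterlim (fun q : R * (R * R) => - A (fst (snd q)) (snd (snd q)) * sin (fst q)
     + B (fst (snd q)) (snd (snd q)) * cos (fst q))
   (filter_prod (locally theta0) (slab_filter T u0 t0))
   (locally (- A u0 t0 * sin theta0 + B u0 t0 * cos theta0))).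
{ assert (L1 : filterlim fst (filter_prod (locally theta0) (slab_filter T u0 t0)) (locally theta0))
    by apply filterlim_fst.
  assert (L2 : filterlim snd (filter_prod (locally theta0) (slab_filter T u0 t0)) (slab_filter T u0 t0))
    by apply filterlim_snd.
  apply (@filterlim_Rplus _ _ FP); apply (@filterlim_Rmult _ _ FP).
  - apply (@filterlim_Ropp _ _ FP).
    exact (filterlim_comp _ _ _ _ _ _ _ _ L2 (CA u0 t0 Ht0)).
  - exact (filterlim_comp _ _ _ _ _ _ _ _ L1 (continuous_sin theta0)).
  - exact (filterlim_comp _ _ _ _ _ _ _ _ L2 (CB u0 t0 Ht0)).
  - exact (filterlim_comp _ _ _ _ _ _ _ _ L1 (continuous_cos theta0)). }
destruct (filter_prod_extract _ _ _ _ _ (filterlim_gt _ _ _ 0 H0 LH)) as [d1 Hd1]. simpl in Hd1.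
pose (G := fun u theta t => A u t * cos theta + B u t * sin theta).
assert (HG : is_derive (fun u => G u theta0 t0) u0
   (D_space A u0 t0 * cos theta0 + D_space B u0 t0 * sin theta0)).
{ apply (is_derive_plus (K := R_AbsRing) (V := R_NormedModule)).
  - exact (is_derive_scal_l (fun u => A u t0) u0 _ (cos theta0)
      (Derive_correct _ _ (ex_derive_space T A u0 t0 Hx Ht0))).
  - exact (is_derive_scal_l (fun u => B u t0) u0 _ (sin theta0)
      (Derive_correct _ _ (ex_derive_space T B u0 t0 Hy Ht0))). }
apply is_derive_caratheodory in HG. destruct HG as [b [Lb Eb]].
destruct (filter_and _ _ (filterlim_lt _ _ _ 0 Hb Lb) Eb) as [d2 Hd2].
apply filterlim_locally. intros e.
(* The bound e/2 puts the root strictly within e of [u0], PI singles out the representative, d1/2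
   keeps the orientation at the root, and d2/2 keeps u0 ± d where the slope [b] is negative. *)
pose (d := Rmin (Rmin (e / 2) PI) (Rmin (d1 / 2) (d2 / 2))).
assert (Hd : 0 < d /\ d <= e / 2 /\ d <= PI /\ d <= d1 / 2 /\ d <= d2 / 2).
{ assert (He := cond_pos e). assert (He1 := cond_pos d1). assert (He2 := cond_pos d2).
  unfold d. split; [repeat apply Rmin_glb_lt; lra|].
  generalize (Rmin_l (Rmin (e/2) PI) (Rmin (d1/2) (d2/2))) (Rmin_r (Rmin (e/2) PI) (Rmin (d1/2) (d2/2)))
    (Rmin_l (e/2) PI) (Rmin_r (e/2) PI) (Rmin_l (d1/2) (d2/2)) (Rmin_r (d1/2) (d2/2)). lra. }
clearbody d.
assert (He := cond_pos e). assert (He1 := cond_pos d1). assert (He2 := cond_pos d2).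
assert (Hball : forall y, Rabs (y - u0) < d2 -> b y < 0 /\ G y theta0 t0 - G u0 theta0 t0 = b y * (y - u0)).
{ intros y Hy'. apply Hd2. unfold ball; simpl; unfold AbsRing_ball, abs, minus, plus, opp; simpl. exact Hy'. }
assert (G00 : G u0 theta0 t0 = 0) by exact G0.
(* The negative slope makes [G] change sign from plus to minus across [u0]. The signs at the two
   fixed ends persist for nearby (theta, t) and trap a root between them. *)
assert (Gp : 0 < G (u0 - d) theta0 t0).
{ destruct (Hball (u0 - d)) as [P Q]; [apply Rabs_def1; lra|].
  replace (u0 - d - u0) with (- d) in Q by ring. nra. }
assert (Gm : G (u0 + d) theta0 t0 < 0).
{ destruct (Hball (u0 + d)) as [P Q]; [apply Rabs_def1; lra|].
  replace (u0 + d - u0) with d in Q by ring. nra. }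
assert (LG : forall u, filterlim (fun p => G u (fst p) (snd p)) (slab_filter T theta0 t0)
   (locally (G u theta0 t0))).
{ intros u.
  assert (Lu : filterlim (fun p : R * R => (u, snd p)) (slab_filter T theta0 t0) (slab_filter T u t0)).
  { apply filterlim_slab; [apply slab_filter_filter|apply filterlim_const|apply slab_snd|apply slab_filter_dom]. }
  unfold G. apply filterlim_Rplus; [apply slab_filter_filter| |];
    (apply filterlim_Rmult; [apply slab_filter_filter| |]).
  - exact (filterlim_comp _ _ _ _ _ _ _ _ Lu (CA u t0 Ht0)).
  - exact (slab_fst_fun T cos theta0 t0 (continuous_cos theta0)).
  - exact (filterlim_comp _ _ _ _ _ _ _ _ Lu (CB u t0 Ht0)).
  - exact (slab_fst_fun T sin theta0 t0 (continuous_sin theta0)). }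
generalize (filter_and _ _ (slab_filter_dom T theta0 t0)
  (filter_and _ _ (filter_and _ _ (filterlim_gt _ _ _ 0 Gp (LG (u0 - d)))
                                  (filterlim_lt _ _ _ 0 Gm (LG (u0 + d))))
    (filter_and _ _ (proj1 (filterlim_locally _ _) (slab_fst T theta0 t0) d1)
                    (proj1 (filterlim_locally _ _) (slab_snd T theta0 t0) d1)))).
apply filter_imp. intros [theta t]. simpl. intros [Ht [[Gp' Gm'] [B1 B2]]].
unfold ball in B1, B2 |- *; simpl in B1, B2 |- *;
  unfold AbsRing_ball, abs, minus, plus, opp in B1, B2 |- *; simpl in B1, B2 |- *.
destruct (IVT_gen (fun u => G u theta t) (u0 - d) (u0 + d) 0) as [u [Hu Eu]].
- intros z. apply continuity_pt_filterlim. unfold G.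
  apply (filterlim_Rplus (locally z)); apply (filterlim_Rmult (locally z)); try apply filterlim_const.
  + exact (ex_derive_continuous (fun v => A v t) z (ex_derive_space T A z t Hx Ht)).
  + exact (ex_derive_continuous (fun v => B v t) z (ex_derive_space T B z t Hy Ht)).
- rewrite Rmin_right, Rmax_left by lra. lra.
- rewrite Rmin_left, Rmax_right in Hu by lra.
  assert (Hu' : Rabs (u - u0) <= d) by (apply Rabs_le; lra).
  assert (Hor : 0 < - A u t * sin theta + B u t * cos theta).
  { apply (Hd1 theta u t); [exact B1|lra|exact B2|exact Ht]. }
  destruct (angle_param_unique T F theta t u HF Ht Eu Hor) as [n Hn].
  assert (Hmt := Hm' theta t).
  assert (E : angle_param F theta t + IZR (m theta t) * (2 * PI) = u + IZR (n + m theta t) * (2 * PI)).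
  { rewrite Hn, plus_IZR. ring. }
  rewrite E in Hmt |- *.
  (* [G] is not zero at the ends, so the root lies strictly within π of [u0]. The chosen
     representative lies in [u0 - π, u0 + π), hence the two differ by less than 2π and the integer
     between them is 0. *)
  destruct (Rle_lt_or_eq_dec (u0 - d) u (proj1 Hu)) as [Hlt|Heq];
    [|subst u; simpl in Eu; lra].
  destruct (Rle_lt_or_eq_dec u (u0 + d) (proj2 Hu)) as [Hlt'|Heq];
    [|subst u; simpl in Eu; lra].
  rewrite (IZR_2PI_small (n + m theta t)) by (apply Rabs_def1; lra).
  apply Rle_lt_trans with d; [|lra]. rewrite Rmult_0_l, Rplus_0_r. exact Hu'.
Qed.

(* The derivatives of [angle_param] in theta and t, from implicit differentiation of
   <F_u, (cos theta, sin theta)> = 0. *)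
Definition angle_param_theta (F : R -> R -> R * R) (theta t : R) : R :=
  - ((- at_angle F (D_space (xcoord F)) theta t * sin theta
      + at_angle F (D_space (ycoord F)) theta t * cos theta) * / bend F theta t).

Definition angle_param_time (T : Rbar) (F : R -> R -> R * R) (theta t : R) : R :=
  - ((at_angle F (D_time T (D_space (xcoord F))) theta t * cos theta
      + at_angle F (D_time T (D_space (ycoord F))) theta t * sin theta) * / bend F theta t).

(** Implicit differentiation with slopes: in the increment of <F_u(v, t), n> = 0, the factor of v -
    v(theta0, t0) tends to [bend], which is not zero, so the identity can be solved for the
    increment of v. Continuity of v is what allows the slopes of F_u to be taken along (v, t). *)
Lemma angle_selection_diff (T : Rbar) (F : R -> R -> R * R) (theta0 t0 : R) :
  convex_evolution T F -> time_dom T t0 ->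
  exists v : R -> R -> R,
    v theta0 t0 = angle_param F theta0 t0 /\
    (forall theta t, exists m : Z, v theta t = angle_param F theta t + IZR m * (2 * PI)) /\
    slab_diff T v theta0 t0 (angle_param_theta F theta0 t0) (angle_param_time T F theta0 t0).
Proof.
intros HF Ht0.
destruct (angle_selection T F theta0 t0 HF Ht0) as [v [E0 [Hv Lv]]].
exists v. split; [exact E0|split; [exact Hv|]].
assert (Hx := closed_smooth_D_space _ _ (closed_smooth_xcoord T F HF)).
assert (Hy := closed_smooth_D_space _ _ (closed_smooth_ycoord T F HF)).
assert (Hb := bend_neg T F theta0 t0 HF Ht0).
unfold angle_param_theta, angle_param_time. unfold bend, at_angle in *.
rewrite <- E0 in *. set (u0 := v theta0 t0) in *.
set (A := D_space (xcoord F)) in *. set (B := D_space (ycoord F)) in *.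
assert (HG : forall theta t, time_dom T t -> A (v theta t) t * cos theta + B (v theta t) t * sin theta = 0).
{ intros theta t Ht. destruct (Hv theta t) as [m E]. rewrite E.
  rewrite (closed_smooth_shift T A m _ t Hx Ht), (closed_smooth_shift T B m _ t Hy Ht).
  apply (angle_param_spec T F theta t HF Ht). }
destruct (C_1_slab_diff T A u0 t0 (proj1 Hx 1%nat) Ht0) as [a1 [b1 [La1 [Lb1 E1]]]].
destruct (C_1_slab_diff T B u0 t0 (proj1 Hy 1%nat) Ht0) as [a2 [b2 [La2 [Lb2 E2]]]].
destruct (proj1 (is_derive_caratheodory _ _ _) (is_derive_cos theta0)) as [c [Lc Ec]].
destruct (proj1 (is_derive_caratheodory _ _ _) (is_derive_sin theta0)) as [s [Ls Es]].
assert (FF := slab_filter_filter T theta0 t0).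
pose (V := fun p : R * R => (v (fst p) (snd p), snd p)).
assert (LV : filterlim V (slab_filter T theta0 t0) (slab_filter T u0 t0)).
{ apply (filterlim_slab (slab_filter T theta0 t0)); [exact Lv|apply slab_snd|apply slab_filter_dom]. }
assert (La1' := filterlim_comp _ _ _ _ _ _ _ _ LV La1).
assert (La2' := filterlim_comp _ _ _ _ _ _ _ _ LV La2).
assert (Lb1' := filterlim_comp _ _ _ _ _ _ _ _ LV Lb1).
assert (Lb2' := filterlim_comp _ _ _ _ _ _ _ _ LV Lb2).
assert (Lc' := filterlim_comp _ _ _ _ _ _ _ _ (slab_fst T theta0 t0) Lc).
assert (Ls' := filterlim_comp _ _ _ _ _ _ _ _ (slab_fst T theta0 t0) Ls).
assert (Lcos := slab_fst_fun T cos theta0 t0 (continuous_cos theta0)).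
assert (Lsin := slab_fst_fun T sin theta0 t0 (continuous_sin theta0)).
assert (LD := filterlim_Rplus _ _ _ _ _ (filterlim_Rmult _ _ _ _ _ La1' Lcos)
                                        (filterlim_Rmult _ _ _ _ _ La2' Lsin)).
assert (LB := filterlim_Rplus _ _ _ _ _ (filterlim_Rmult _ _ _ _ _ Lb1' Lcos)
                                        (filterlim_Rmult _ _ _ _ _ Lb2' Lsin)).
assert (LC := filterlim_Rplus _ _ _ _ _
  (filterlim_Rmult _ _ _ _ _ (filterlim_const (F := slab_filter T theta0 t0) (A u0 t0)) Lc')
  (filterlim_Rmult _ _ _ _ _ (filterlim_const (F := slab_filter T theta0 t0) (B u0 t0)) Ls')).
assert (LDi := filterlim_Rinv _ _ _ (Rlt_not_eq _ _ Hb) LD).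
(* The slopes are left open and read off from the limits: minus the quotients of the expressions in
   [LC] and [LB] by the one in [LD]. *)
eexists. eexists. split; [|split].
- replace (- A u0 t0 * sin theta0 + B u0 t0 * cos theta0)
    with (A u0 t0 * - sin theta0 + B u0 t0 * cos theta0) by ring.
  exact (filterlim_Ropp _ _ _ (filterlim_Rmult _ _ _ _ _ LC LDi)).
- exact (filterlim_Ropp _ _ _ (filterlim_Rmult _ _ _ _ _ LB LDi)).
- assert (E1' := LV _ E1). assert (E2' := LV _ E2).
  assert (Ec' := slab_fst T theta0 t0 _ Ec). assert (Es' := slab_fst T theta0 t0 _ Es).
  unfold filtermap in E1', E2', Ec', Es'.
  generalize (filter_and _ _ (slab_filter_dom T theta0 t0)
    (filter_and _ _ (filterlim_neq0 _ _ _ (Rlt_not_eq _ _ Hb) LD)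
    (filter_and _ _ (filter_and _ _ E1' E2') (filter_and _ _ Ec' Es')))).
  apply filter_imp. intros [theta t]. unfold V. simpl.
  intros [Ht [Hn [[Q1 Q2] [Q3 Q4]]]].
  assert (G1 := HG theta t Ht). assert (G0 := HG theta0 t0 Ht0). fold u0 in G0.
  set (v' := v theta t) in *.
  set (D := a1 (v', t) * cos theta + a2 (v', t) * sin theta) in *.
  apply Rmult_eq_reg_l with D; [|exact Hn].
  transitivity (- (A u0 t0 * c theta + B u0 t0 * s theta) * (theta - theta0)
    - (b1 (v', t) * cos theta + b2 (v', t) * sin theta) * (t - t0)); [|field; exact Hn].
  (* The difference of the defining equation at the two points, split so that first F_u changes at
     the new angle and then the angle changes with F_u at the base point. *)
  assert (E : 0 = (A v' t - A u0 t0) * cos theta + (B v' t - B u0 t0) * sin theta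
    + A u0 t0 * (cos theta - cos theta0) + B u0 t0 * (sin theta - sin theta0)) by lra.
  rewrite Q1, Q2, Q3, Q4 in E. unfold D. fold u0. lra.
Qed.

(** By periodicity [P] takes the same values at the differentiable representative as at
    [angle_param], so the chain rule applies although [angle_param] itself may jump. *)
Lemma at_angle_slab_diff (T : Rbar) (F : R -> R -> R * R) (P : R -> R -> R) (theta t : R) :
  convex_evolution T F -> closed_smooth T P -> time_dom T t ->
  slab_diff T (at_angle F P) theta t
    (at_angle F (D_space P) theta t * angle_param_theta F theta t)
    (at_angle F (D_time T P) theta t
     + at_angle F (D_space P) theta t * angle_param_time T F theta t).
Proof.
intros HF HP Ht.
destruct (angle_selection_diff T F theta t HF Ht) as [v [E0 [Hv Dv]]].
apply (slab_diff_ext_loc T (fun y r => P (v y r) r)); [exact Ht| |].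
- generalize (slab_filter_dom T theta t). apply filter_imp. intros p Hp.
  destruct (Hv (fst p) (snd p)) as [m E]. rewrite E.
  exact (closed_smooth_shift T P m _ _ HP Hp).
- apply (slab_diff_comp T P v theta t _ _ _ _ Ht Dv).
  unfold at_angle. rewrite <- E0. exact (C_1_slab_diff T P _ t (proj1 HP 1%nat) Ht).
Qed.

Lemma at_angle_continuous (T : Rbar) (F : R -> R -> R * R) (P : R -> R -> R) :
  convex_evolution T F -> closed_smooth T P -> continuous_family T (at_angle F P).
Proof.
intros HF HP theta t Ht.
exact (slab_diff_continuous T _ _ _ _ _ (at_angle_slab_diff T F P theta t HF HP Ht)).
Qed.

(** * The support function of the flow *)

(** The component of a vector (P, Q), taken at w, along a vector (c, s) depending on theta. S,
    S_theta and S_t all have this form, so one differentiation rule covers every derivative up to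
    order two. *)
Definition frame_comb (F : R -> R -> R * R) (P Q : R -> R -> R) (c s : R -> R) (theta t : R) : R :=
  at_angle F P theta t * c theta + at_angle F Q theta t * s theta.

Definition frame_comb_theta (F : R -> R -> R * R) (P Q : R -> R -> R) (c s c' s' : R -> R)
    (theta t : R) : R :=
  at_angle F (D_space P) theta t * angle_param_theta F theta t * c theta
  + at_angle F P theta t * c' theta
  + (at_angle F (D_space Q) theta t * angle_param_theta F theta t * s theta
     + at_angle F Q theta t * s' theta).

Definition frame_comb_time (T : Rbar) (F : R -> R -> R * R) (P Q : R -> R -> R) (c s : R -> R)
    (theta t : R) : R :=
  (at_angle F (D_time T P) theta t + at_angle F (D_space P) theta t * angle_param_time T F theta t)
    * c theta
  + (at_angle F (D_time T Q) theta t + at_angle F (D_space Q) theta t * angle_param_time T F theta t)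
    * s theta.

Lemma frame_comb_slab_diff (T : Rbar) (F : R -> R -> R * R) (P Q : R -> R -> R)
    (c s c' s' : R -> R) (theta t : R) :
  convex_evolution T F -> closed_smooth T P -> closed_smooth T Q -> time_dom T t ->
  is_derive c theta (c' theta) -> is_derive s theta (s' theta) ->
  slab_diff T (frame_comb F P Q c s) theta t
    (frame_comb_theta F P Q c s c' s' theta t) (frame_comb_time T F P Q c s theta t).
Proof.
intros HF HP HQ Ht Hc Hs.
assert (H1 := slab_diff_mult T _ _ theta t _ _ _ _
  (at_angle_slab_diff T F P theta t HF HP Ht) (slab_diff_space_fun T c theta t _ Hc)).
assert (H2 := slab_diff_mult T _ _ theta t _ _ _ _
  (at_angle_slab_diff T F Q theta t HF HQ Ht) (slab_diff_space_fun T s theta t _ Hs)).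
assert (H := slab_diff_plus T _ _ theta t _ _ _ _ H1 H2).
unfold frame_comb_theta, frame_comb_time.
match type of H with slab_diff _ _ _ _ ?a ?b =>
  match goal with |- slab_diff _ _ _ _ ?a' ?b' => replace a' with a by ring; replace b' with b by ring end end.
exact H.
Qed.

Lemma bend_continuous (T : Rbar) (F : R -> R -> R * R) :
  convex_evolution T F -> continuous_family T (bend F).
Proof.
intros HF.
assert (Hx := closed_smooth_D_space _ _ (closed_smooth_D_space _ _ (closed_smooth_xcoord T F HF))).
assert (Hy := closed_smooth_D_space _ _ (closed_smooth_D_space _ _ (closed_smooth_ycoord T F HF))).
apply continuous_family_plus; apply continuous_family_mult;
  auto using at_angle_continuous, continuous_family_space, continuous_cos, continuous_sin.
Qed.

Lemma angle_param_theta_continuous (T : Rbar) (F : R -> R -> R * R) :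
  convex_evolution T F -> continuous_family T (angle_param_theta F).
Proof.
intros HF.
assert (Hx := closed_smooth_D_space _ _ (closed_smooth_xcoord T F HF)).
assert (Hy := closed_smooth_D_space _ _ (closed_smooth_ycoord T F HF)).
apply continuous_family_opp, continuous_family_mult.
- apply continuous_family_plus; apply continuous_family_mult;
    auto using at_angle_continuous, continuous_family_opp, continuous_family_space,
      continuous_cos, continuous_sin.
- apply continuous_family_inv; [|exact (bend_continuous T F HF)].
  intros x t Ht. apply Rlt_not_eq. exact (bend_neg T F x t HF Ht).
Qed.

Lemma angle_param_time_continuous (T : Rbar) (F : R -> R -> R * R) :
  convex_evolution T F -> continuous_family T (angle_param_time T F).
Proof.
intros HF.
assert (Hx := closed_smooth_D_time _ _ (closed_smooth_D_space _ _ (closed_smooth_xcoord T F HF))).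
assert (Hy := closed_smooth_D_time _ _ (closed_smooth_D_space _ _ (closed_smooth_ycoord T F HF))).
apply continuous_family_opp, continuous_family_mult.
- apply continuous_family_plus; apply continuous_family_mult;
    auto using at_angle_continuous, continuous_family_space, continuous_cos, continuous_sin.
- apply continuous_family_inv; [|exact (bend_continuous T F HF)].
  intros x t Ht. apply Rlt_not_eq. exact (bend_neg T F x t HF Ht).
Qed.

(** The function [g] is kept apart from the combination because S_theta and S_t are known to equal
    it only at times in [0,T). *)
Lemma frame_comb_C_1 (T : Rbar) (F : R -> R -> R * R) (P Q g : R -> R -> R)
    (c s c' s' : R -> R) :
  convex_evolution T F -> closed_smooth T P -> closed_smooth T Q ->
  (forall x, is_derive c x (c' x)) -> (forall x, is_derive s x (s' x)) ->
  (forall x, continuous c' x) -> (forall x, continuous s' x) ->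
  (forall x t, time_dom T t -> frame_comb F P Q c s x t = g x t) ->
  C_n T 1 g.
Proof.
intros HF HP HQ Hc Hs Lc' Ls' Hg.
assert (Lc : forall x, continuous c x) by (intros x; apply (ex_derive_continuous c); eexists; apply Hc).
assert (Ls : forall x, continuous s x) by (intros x; apply (ex_derive_continuous s); eexists; apply Hs).
assert (HPs := closed_smooth_D_space T P HP). assert (HQs := closed_smooth_D_space T Q HQ).
assert (HPt := closed_smooth_D_time T P HP). assert (HQt := closed_smooth_D_time T Q HQ).
assert (La := angle_param_theta_continuous T F HF).
assert (Lb := angle_param_time_continuous T F HF).
apply (C_1_intro T g (frame_comb_theta F P Q c s c' s') (frame_comb_time T F P Q c s)).
- intros x t Ht. apply (slab_diff_ext T (frame_comb F P Q c s)); [exact Ht|exact Hg|].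
  apply frame_comb_slab_diff; auto.
- repeat (apply continuous_family_plus || apply continuous_family_mult);
    auto using at_angle_continuous, continuous_family_space.
- repeat (apply continuous_family_plus || apply continuous_family_mult);
    auto using at_angle_continuous, continuous_family_space.
Qed.

Definition support_family (F : R -> R -> R * R) (theta t : R) : R := support (fun u => F u t) theta.

Lemma support_family_eq (F : R -> R -> R * R) (theta t : R) :
  support_family F theta t = frame_comb F (xcoord F) (ycoord F) cos sin theta t.
Proof. reflexivity. Qed.

(** With n = (cos, sin), the derivatives of the frame are n' = ([nsin], [cos]) and n'' = ([ncos],
    [nsin]); the names let them be passed as functions. *)
Definition nsin (x : R) : R := - sin x.
Definition ncos (x : R) : R := - cos x.

Lemma is_derive_nsin (x : R) : is_derive nsin x (ncos x).
Proof. exact (is_derive_opp sin x (cos x) (is_derive_sin x)). Qed.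

Lemma continuous_nsin (x : R) : continuous nsin x.
Proof. apply (ex_derive_continuous nsin). eexists. apply is_derive_nsin. Qed.

Lemma continuous_ncos (x : R) : continuous ncos x.
Proof. exact (continuous_opp cos x (continuous_cos x)). Qed.

Lemma support_slab_diff (T : Rbar) (F : R -> R -> R * R) (theta t : R) :
  convex_evolution T F -> time_dom T t ->
  slab_diff T (support_family F) theta t
    (frame_comb F (xcoord F) (ycoord F) nsin cos theta t)
    (frame_comb F (D_time T (xcoord F)) (D_time T (ycoord F)) cos sin theta t).
Proof.
intros HF Ht.
assert (Hx := closed_smooth_xcoord T F HF). assert (Hy := closed_smooth_ycoord T F HF).
assert (H := frame_comb_slab_diff T F (xcoord F) (ycoord F) cos sin nsin cos theta t
  HF Hx Hy Ht (is_derive_cos theta) (is_derive_sin theta)).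
destruct (angle_param_spec T F theta t HF Ht) as [E _].
unfold frame_comb_theta, frame_comb_time in H.
match type of H with slab_diff _ _ _ _ ?a ?b =>
  match goal with |- slab_diff _ _ _ _ ?a' ?b' => replace a' with a; [replace b' with b; [exact H|]|] end end;
  unfold frame_comb.
- transitivity (at_angle F (D_time T (xcoord F)) theta t * cos theta
    + at_angle F (D_time T (ycoord F)) theta t * sin theta
    + angle_param_time T F theta t * (at_angle F (D_space (xcoord F)) theta t * cos theta
      + at_angle F (D_space (ycoord F)) theta t * sin theta)); [ring|rewrite E; ring].
- transitivity (at_angle F (xcoord F) theta t * nsin theta + at_angle F (ycoord F) theta t * cos theta
    + angle_param_theta F theta t * (at_angle F (D_space (xcoord F)) theta t * cos theta
      + at_angle F (D_space (ycoord F)) theta t * sin theta)); [ring|rewrite E; ring].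
Qed.

Lemma D_space_support (T : Rbar) (F : R -> R -> R * R) (theta t : R) :
  convex_evolution T F -> time_dom T t ->
  D_space (support_family F) theta t = frame_comb F (xcoord F) (ycoord F) nsin cos theta t.
Proof. intros HF Ht. exact (D_space_eq T _ _ _ _ _ Ht (support_slab_diff T F theta t HF Ht)). Qed.

Lemma D_time_support (T : Rbar) (F : R -> R -> R * R) (theta t : R) :
  convex_evolution T F -> time_dom T t ->
  D_time T (support_family F) theta t =
  frame_comb F (D_time T (xcoord F)) (D_time T (ycoord F)) cos sin theta t.
Proof. intros HF Ht. exact (D_time_eq T _ _ _ _ _ Ht (support_slab_diff T F theta t HF Ht)). Qed.

Lemma D_space_support_slab_diff (T : Rbar) (F : R -> R -> R * R) (theta t : R) :
  convex_evolution T F -> time_dom T t ->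
  slab_diff T (D_space (support_family F)) theta t
    (frame_comb_theta F (xcoord F) (ycoord F) nsin cos ncos nsin theta t)
    (frame_comb_time T F (xcoord F) (ycoord F) nsin cos theta t).
Proof.
intros HF Ht.
apply (slab_diff_ext T (frame_comb F (xcoord F) (ycoord F) nsin cos)); [exact Ht| |].
- intros y r Hr. symmetry. exact (D_space_support T F y r HF Hr).
- apply frame_comb_slab_diff; auto using closed_smooth_xcoord, closed_smooth_ycoord.
  + apply is_derive_nsin.
  + apply is_derive_cos.
Qed.

Lemma D_time_support_slab_diff (T : Rbar) (F : R -> R -> R * R) (theta t : R) :
  convex_evolution T F -> time_dom T t ->
  slab_diff T (D_time T (support_family F)) theta t
    (frame_comb_theta F (D_time T (xcoord F)) (D_time T (ycoord F)) cos sin nsin cos theta t)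
    (frame_comb_time T F (D_time T (xcoord F)) (D_time T (ycoord F)) cos sin theta t).
Proof.
intros HF Ht.
apply (slab_diff_ext T (frame_comb F (D_time T (xcoord F)) (D_time T (ycoord F)) cos sin)); [exact Ht| |].
- intros y r Hr. symmetry. exact (D_time_support T F y r HF Hr).
- apply frame_comb_slab_diff;
    auto using closed_smooth_D_time, closed_smooth_xcoord, closed_smooth_ycoord.
  + apply is_derive_cos.
  + apply is_derive_sin.
Qed.

(** As [D_space] and [D_time] are total operators, this is what guarantees that the second
    derivatives in the equation are genuine ones. *)
Lemma support_C_2 (T : Rbar) (F : R -> R -> R * R) :
  convex_evolution T F -> C_n T 2 (support_family F).
Proof.
intros HF.
assert (Hx := closed_smooth_xcoord T F HF). assert (Hy := closed_smooth_ycoord T F HF).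
apply C_n_S_intro.
- intros x t Ht. eexists. eexists. exact (support_slab_diff T F x t HF Ht).
- apply (frame_comb_C_1 T F (xcoord F) (ycoord F) _ nsin cos ncos nsin);
    auto using is_derive_nsin, is_derive_cos, continuous_ncos, continuous_nsin.
  intros x t Ht. symmetry. exact (D_space_support T F x t HF Ht).
- apply (frame_comb_C_1 T F (D_time T (xcoord F)) (D_time T (ycoord F)) _ cos sin nsin cos);
    auto using closed_smooth_D_time, is_derive_cos, is_derive_sin, continuous_cos, continuous_nsin.
  intros x t Ht. symmetry. exact (D_time_support T F x t HF Ht).
Qed.

(** Since n'' = - n, differentiating <F(w), n'> gives <F_u, n'> w_theta - S, where <F_u, n'> = g and
    w_theta = 1/(k g). The lemma serves both the equation and its hyperbolicity. *)
Lemma support_radius (T : Rbar) (F : R -> R -> R * R) (theta t : R) :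
  convex_evolution T F -> time_dom T t ->
  D_space (D_space (support_family F)) theta t + support_family F theta t =
  / curvature (fun v => F v t) (angle_param F theta t).
Proof.
intros HF Ht.
rewrite (D_space_eq T _ _ _ _ _ Ht (D_space_support_slab_diff T F theta t HF Ht)).
rewrite support_family_eq. unfold frame_comb_theta, frame_comb, angle_param_theta, nsin, ncos.
rewrite (bend_curvature T F theta t HF Ht).
destruct (tangent_at_angle T F theta t HF Ht) as [Hg [E1 E2]]. rewrite E1, E2.
assert (Hk := proj2 (proj2 (evolution_convex _ _ HF t Ht)) (angle_param F theta t)).
assert (Hcs := sin2_cos2 theta). unfold Rsqr in Hcs.
set (g := speed _ _) in *. set (k := curvature _ _) in *.
replace (- (- g * sin theta) * sin theta + g * cos theta * cos theta) with g.
2:{ transitivity (g * (sin theta * sin theta + cos theta * cos theta)); [rewrite Hcs|]; ring. }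
transitivity (/ k * (sin theta * sin theta + cos theta * cos theta)); [field; split; lra|].
rewrite Hcs. ring.
Qed.

(** * The flow and its Monge-Ampère equation *)

Definition curvature_flow (T : Rbar) (F : R -> R -> R * R) : Prop :=
  forall u t, time_dom T t ->
    vD_time T (vD_time T F) u t =
    minus (scal (curvature (fun v => F v t) u) (inner_normal (fun v => F v t) u))
          (grad_rho T F u t).

Lemma curvature_flow_coords (T : Rbar) (F : R -> R -> R * R) (u t : R) :
  curvature_flow T F -> time_dom T t ->
  let g := speed (fun v => F v t) u in
  let k := curvature (fun v => F v t) u in
  let lam := / g * D_space (D_time T (xcoord F)) u t * D_time T (xcoord F) u t
           + / g * D_space (D_time T (ycoord F)) u t * D_time T (ycoord F) u t in
  D_time T (D_time T (xcoord F)) u t =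
    k * - (/ g * D_space (ycoord F) u t) + - (lam * (/ g * D_space (xcoord F) u t)) /\
  D_time T (D_time T (ycoord F)) u t =
    k * (/ g * D_space (xcoord F) u t) + - (lam * (/ g * D_space (ycoord F) u t)).
Proof.
intros Hflow Ht. exact (conj (f_equal fst (Hflow u t Ht)) (f_equal snd (Hflow u t Ht))).
Qed.

(* The component of F_t along F_u is conserved: the tangential part of the acceleration, - grad rho,
   exactly cancels <F_t, F_tu>. *)
Lemma velocity_tangential_conserved (T : Rbar) (F : R -> R -> R * R) (u t : R) :
  convex_evolution T F -> curvature_flow T F -> time_dom T t ->
  let tang := fun r => D_time T (xcoord F) u r * D_space (xcoord F) u r
                       + D_time T (ycoord F) u r * D_space (ycoord F) u r in
  tang t = tang 0.
Proof.
intros HF Hflow Ht tang. apply (time_constant T tang t); [|exact Ht]. clear t Ht. intros t Ht.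
assert (Hx := closed_smooth_xcoord T F HF). assert (Hy := closed_smooth_ycoord T F HF).
assert (Dx := C_1_slab_diff T _ u t (proj1 (closed_smooth_D_space _ _ Hx) 1%nat) Ht).
assert (Dy := C_1_slab_diff T _ u t (proj1 (closed_smooth_D_space _ _ Hy) 1%nat) Ht).
assert (Dxt := C_1_slab_diff T _ u t (proj1 (closed_smooth_D_time _ _ Hx) 1%nat) Ht).
assert (Dyt := C_1_slab_diff T _ u t (proj1 (closed_smooth_D_time _ _ Hy) 1%nat) Ht).
assert (D := slab_diff_time T _ _ _ _ _ Ht (slab_diff_plus T _ _ u t _ _ _ _
  (slab_diff_mult T _ _ u t _ _ _ _ Dxt Dx) (slab_diff_mult T _ _ u t _ _ _ _ Dyt Dy))).
(* The product rule yields the time derivative of F_u, whereas grad rho contains the u-derivative of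
   F_t; they agree at t = 0 as well. *)
rewrite (D_time_D_space T (xcoord F) u t (proj1 Hx 2%nat) Ht) in D.
rewrite (D_time_D_space T (ycoord F) u t (proj1 Hy 2%nat) Ht) in D.
destruct (curvature_flow_coords T F u t Hflow Ht) as [E1 E2].
assert (Hg := speed_pos (fun v => F v t) u (proj1 (evolution_convex _ _ HF t Ht) u)).
assert (Hg2 : speed (fun v => F v t) u * speed (fun v => F v t) u =
  D_space (xcoord F) u t * D_space (xcoord F) u t + D_space (ycoord F) u t * D_space (ycoord F) u t)
  by exact (speed_sqr (fun v => F v t) u).
rewrite E1, E2 in D. clear E1 E2 Dx Dy Dxt Dyt.
set (g := speed _ _) in *. set (k := curvature _ _) in *.
match type of D with is_derive_within _ _ _ ?l => replace 0 with l; [exact D|] end.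
set (a := D_space (xcoord F) u t) in *. set (b := D_space (ycoord F) u t) in *.
set (lam := / g * _ * _ + _).
(* The curvature term is orthogonal to F_u. What remains is <F_t, F_tu> = g lam and the tangential
   acceleration - (lam / g) F_u paired with F_u, which cancel because |F_u|^2 = g^2. *)
transitivity (g * lam - lam * / g * (a * a + b * b)); [|rewrite <- Hg2; field; lra].
unfold lam. field. lra.
Qed.

Lemma support_monge_ampere (T : Rbar) (F : R -> R -> R * R) (theta t : R) :
  convex_evolution T F -> curvature_flow T F ->
  (forall u, D_time T (xcoord F) u 0 * D_space (xcoord F) u 0
             + D_time T (ycoord F) u 0 * D_space (ycoord F) u 0 = 0) ->
  time_dom T t ->
  let S := support_family F in
  S theta t * D_time T (D_time T S) theta t
  + D_time T (D_time T S) theta t * D_space (D_space S) theta t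
  - D_time T (D_space S) theta t ^ 2 + 1 = 0.
Proof.
intros HF Hflow H0 Ht S.
set (u := angle_param F theta t).
set (k := curvature (fun v => F v t) u). set (g := speed (fun v => F v t) u).
set (w := angle_param_time T F theta t).
assert (Hx := closed_smooth_xcoord T F HF). assert (Hy := closed_smooth_ycoord T F HF).
destruct (tangent_at_angle T F theta t HF Ht) as [Hg [E1 E2]]. fold u g in Hg, E1, E2.
assert (Hk : 0 < k) by exact (proj2 (proj2 (evolution_convex _ _ HF t Ht)) u).
assert (Hcs := sin2_cos2 theta). unfold Rsqr in Hcs.
assert (Hrad : D_space (D_space S) theta t + S theta t = / k) by exact (support_radius T F theta t HF Ht).
assert (Htan := velocity_tangential_conserved T F u t HF Hflow Ht). simpl in Htan.
rewrite H0 in Htan.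
change (D_space (xcoord F) u t) with (at_angle F (D_space (xcoord F)) theta t) in Htan.
change (D_space (ycoord F) u t) with (at_angle F (D_space (ycoord F)) theta t) in Htan.
rewrite E1, E2 in Htan.
(* Dividing by the speed turns conservation into <F_t, n'> = 0, which leaves only the term with w_t
   in the mixed derivative. *)
assert (Htan' : - D_time T (xcoord F) u t * sin theta + D_time T (ycoord F) u t * cos theta = 0).
{ apply Rmult_eq_reg_l with g; [|lra]. rewrite Rmult_0_r, <- Htan. ring. }
assert (Hmix : D_time T (D_space S) theta t = g * w).
{ unfold S. rewrite (D_time_eq T _ _ _ _ _ Ht (D_space_support_slab_diff T F theta t HF Ht)).
  unfold frame_comb_time, nsin. fold w. rewrite E1, E2. unfold at_angle. fold u.
  transitivity ((- D_time T (xcoord F) u t * sin theta + D_time T (ycoord F) u t * cos theta)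
    + g * w * (sin theta * sin theta + cos theta * cos theta)); [ring|rewrite Htan', Hcs; ring]. }
assert (Hw : D_space (D_time T (xcoord F)) u t * cos theta
           + D_space (D_time T (ycoord F)) u t * sin theta = k * (g * g) * w).
{ unfold w, angle_param_time. rewrite (bend_curvature T F theta t HF Ht). fold u k g.
  unfold at_angle. fold u.
  rewrite (D_time_D_space T (xcoord F) u t (proj1 Hx 2%nat) Ht).
  rewrite (D_time_D_space T (ycoord F) u t (proj1 Hy 2%nat) Ht). field. lra. }
assert (Htt : D_time T (D_time T S) theta t = - k + k * (g * g) * w * w).
{ unfold S. rewrite (D_time_eq T _ _ _ _ _ Ht (D_time_support_slab_diff T F theta t HF Ht)).
  unfold frame_comb_time. fold w. unfold at_angle. fold u.
  destruct (curvature_flow_coords T F u t Hflow Ht) as [A1 A2]. rewrite A1, A2. fold k g.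
  change (D_space (xcoord F) u t) with (at_angle F (D_space (xcoord F)) theta t).
  change (D_space (ycoord F) u t) with (at_angle F (D_space (ycoord F)) theta t).
  rewrite E1, E2. set (lam := / g * _ * _ + _).
  (* The [lam] terms disappear because F_u is orthogonal to n at this parameter; the normal
     acceleration contributes - k, and the motion of the parameter contributes <F_tu, n> w_t. *)
  transitivity (- k * (sin theta * sin theta + cos theta * cos theta)
    + (D_space (D_time T (xcoord F)) u t * cos theta
       + D_space (D_time T (ycoord F)) u t * sin theta) * w); [field; lra|].
  rewrite Hcs, Hw. ring. }
rewrite Hmix, Htt.
(* S_tt is factored out of its two occurrences; its cofactor is the radius of curvature 1/k, so the
   product is - 1 + (g w)^2 and everything cancels. *)
transitivity ((- k + k * (g * g) * w * w) * (D_space (D_space S) theta t + S theta t)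
  - (g * w) ^ 2 + 1); [ring|].
rewrite Hrad. field. lra.
Qed.

Theorem mainTheorem3
  (T : Rbar) (hT : Rbar_lt 0 T)
  (F : R -> R -> R * R) (F0 : R -> R * R) (f : R -> R)
  (hF_closed : forall t, time_dom T t -> periodic (fun u => F u t))
  (hF_smooth : smooth_family T F)
  (hF_convex : forall t, time_dom T t -> strictly_convex (fun u => F u t))
  (hF0_closed : periodic F0)
  (hF0_smooth : smooth_curve F0)
  (hF0_convex : strictly_convex F0)
  (hf_periodic : periodic f)
  (hf_smooth : smooth_fun f)
  (hf_nonneg : forall u, 0 <= f u)
  (hflow : forall u t, time_dom T t ->
     vD_time T (vD_time T F) u t =
     minus (scal (curvature (fun v => F v t) u) (inner_normal (fun v => F v t) u))
           (grad_rho T F u t))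
  (hinit : forall u, F u 0 = F0 u)
  (hinit_vel : forall u, vD_time T F u 0 = scal (f u) (inner_normal F0 u)) :
  let S := fun theta tau : R => support (fun u => F u tau) theta in
  let h := support F0 in
  let f_tilde := fun theta : R => f (normal_param F0 theta) in
  (forall tau, time_dom T tau -> periodic (fun theta => S theta tau)) /\
  C_n T 2 S /\
  (forall theta tau, time_dom T tau ->
     S theta tau * D_time T (D_time T S) theta tau
     + D_time T (D_time T S) theta tau * D_space (D_space S) theta tau
     - D_time T (D_space S) theta tau ^ 2 + 1 = 0) /\
  (forall theta, S theta 0 = h theta) /\
  (forall theta, D_time T S theta 0 = - f_tilde theta) /\
  tau_hyperbolic T flow_MA S.
Proof.
intros S h f_tilde.
assert (HF : convex_evolution T F) by (constructor; assumption).
assert (H0 : time_dom T 0) by (split; [lra|exact hT]).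
(* Equality of functions is needed, since [support] and [normal_param] take the whole curve as
   argument and the choice of parameter depends on it. *)
assert (EF : (fun u => F u 0) = F0) by (apply functional_extensionality; exact hinit).
assert (Hvel : forall u,
   D_time T (xcoord F) u 0 = f u * fst (inner_normal F0 u) /\
   D_time T (ycoord F) u 0 = f u * snd (inner_normal F0 u)).
{ intros u. exact (conj (f_equal fst (hinit_vel u)) (f_equal snd (hinit_vel u))). }
split; [|split; [|split; [|split; [|split]]]].
(* The angle enters the choice of parameter only through its cosine and sine, so at theta + 2π the
   same predicate is passed to [epsilon] and the same parameter comes out. *)
- intros tau _ theta. unfold S, support, normal_point, normal_param.
  rewrite cos_plus, sin_plus, cos_2PI, sin_2PI.
  replace (cos theta * 1 - sin theta * 0) with (cos theta) by ring.
  replace (sin theta * 1 + cos theta * 0) with (sin theta) by ring. reflexivity.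
- exact (support_C_2 T F HF).
- intros theta tau Ht. apply support_monge_ampere; auto.
  (* The initial velocity is a multiple of the normal, so the conserved tangential component starts
     at zero. *)
  intros u. destruct (Hvel u) as [-> ->]. rewrite <- EF.
  rewrite inner_normal_eq. simpl.
  change (Derive (fun v : R => fst (F v 0)) u) with (D_space (xcoord F) u 0).
  change (Derive (fun v : R => snd (F v 0)) u) with (D_space (ycoord F) u 0). ring.
- intros theta. unfold S, h. rewrite EF. reflexivity.
- intros theta.
  assert (E := D_time_support T F theta 0 HF H0).
  refine (eq_trans E _). unfold frame_comb, at_angle, f_tilde.
  (* At this parameter the inner normal is - n, so the normal velocity f paired with n gives - f. *)
  assert (N := angle_param_normal T F theta 0 HF H0).
  unfold angle_param in *. rewrite EF in *.
  destruct (Hvel (normal_param F0 theta)) as [-> ->]. rewrite N. simpl.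
  assert (Hcs := sin2_cos2 theta). unfold Rsqr in Hcs.
  transitivity (- f (normal_param F0 theta) * (sin theta * sin theta + cos theta * cos theta));
    [ring|rewrite Hcs; ring].
(* The discriminant reduces to 4 A E = 4, and S_theta_theta + B is the radius of curvature, the
   inverse of a positive number. *)
- intros theta tau Ht. unfold tau_hyperbolic_at, at_jet, flow_MA. simpl. split; [lra|].
  assert (E := support_radius T F theta tau HF Ht).
  assert (Hk := proj2 (proj2 (hF_convex tau Ht)) (angle_param F theta tau)).
  intros Hc. apply (Rinv_neq_0_compat _ (Rgt_not_eq _ _ Hk)). rewrite <- E. exact Hc.
Qed.
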